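(* There exists a minimal, not uniquely ergodic interval exchange transformation $T:[0,1)\to[0,1)$ such that the complement in $[0,1)$ of the set of points that are generic for Lebesgue measure has Hausdorff dimension $0$ (with respect to the usual metric).
   Context: An $n$-interval exchange transformation (IET) is a map $T:[0,1)\to[0,1)$ given by lengths $l_1,\dots,l_n>0$ with $\sum l_i=1$ and a permutation $\pi$ of $\{1,\dots,n\}$: with $I_j=[l_1+\dots+l_{j-1},\,l_1+\dots+l_j)$, $T(x)=x-\sum_{k<j}l_k+\sum_{\pi(k')<\pi(j)}l_{k'}$ for $x\in I_j$. $T$ is minimal if every orbit is dense. Given a $\mu$-ergodic map $T$, a point $x_0\in[0,1)$ is *generic for* $\mu$ if for every $f\in C([0,1])$ the limit $\lim_{N\to\infty}\frac1N\sum_{n=1}^N f(T^n(x_0))$ exists and equals $\int_0^1 f\,d\mu$. *)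

(* Defs.v *)
From HB Require Import structures.
From mathcomp Require Import all_boot all_order all_algebra perm.
From mathcomp Require Import all_classical all_reals all_analysis.
Set Implicit Arguments.
Unset Strict Implicit.
Unset Printing Implicit Defensive.
Import Order.TTheory GRing.Theory Num.Theory.
Import numFieldNormedType.Exports.
Local Open Scope classical_set_scope.
Local Open Scope ring_scope.

(* A self-map of [0, 1) is represented by a function T : R -> R. Every
   definition below depends only on the values of T on [0, 1), and every
   measure on [0, 1) only through its values on Borel subsets of [0, 1). *)

Section iet.
Context {R : realType}.
Implicit Type T : R -> R.

Definition iet_interval n (l : 'I_n -> R) (j : 'I_n) : set R :=
  `[\sum_(k < n | (k < j)%N) l k, \sum_(k < n | (k <= j)%N) l k[.

Definition is_iet T :=
  exists (n : nat) (l : 'I_n -> R) (pi : 'S_n),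
    [/\ forall j, 0 < l j,
        \sum_(j < n) l j = 1 &
        forall j x, x \in iet_interval l j ->
          T x = x - \sum_(k < n | (k < j)%N) l k
                  + \sum_(k < n | (pi k < pi j)%N) l k].

Definition minimal_map T :=
  forall x : R, x \in `[0, 1[ -> `[0, 1[ `<=` closure (range (fun n => iter n T x)).

Definition invariant_measure T (mu : {measure set (measurableTypeR R) -> \bar R}) :=
  forall A : set (measurableTypeR R), measurable A -> A `<=` `[0, 1[ ->
    mu (`[0, 1[ `&` T @^-1` A) = mu A.

Definition ergodic_measure T (mu : {measure set (measurableTypeR R) -> \bar R}) :=
  invariant_measure T mu /\
  forall A : set (measurableTypeR R), measurable A -> A `<=` `[0, 1[ ->
    `[0, 1[ `&` T @^-1` A = A -> mu A = 0%E \/ mu (`[0, 1[ `\` A) = 0%E.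

Definition invariant_probability T (mu : probability (measurableTypeR R) R) :=
  mu `[0, 1[%classic = 1%E /\ invariant_measure T mu.

Definition uniquely_ergodic T :=
  exists2 mu : probability (measurableTypeR R) R, invariant_probability T mu &
    forall nu : probability (measurableTypeR R) R, invariant_probability T nu ->
      forall A : set (measurableTypeR R), measurable A -> nu A = mu A.

Definition generic_point T (mu : {measure set (measurableTypeR R) -> \bar R}) (x : R) :=
  forall f : R -> R, {within `[0, 1], continuous f} ->
    (fun N : nat => N%:R^-1 * \sum_(1 <= n < N.+1) f (iter n T x)) @ \oo
      --> (\int[mu]_(t in `[0, 1[) f t)%R.

End iet.

Section hausdorff.
Context {R : realType}.
Local Open Scope ereal_scope.
Implicit Type (A U : set R) (s delta : R).

Definition diameter U : \bar R :=
  ereal_sup [set `|p.1 - p.2|%:E | p in U `*` U].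

(* The empty set contributes 0 also when s = 0, while nonempty sets of
   diameter 0 then contribute 0 `^ 0 = 1. *)
Definition diameter_pow s U : \bar R :=
  if pselect (U = set0) then 0 else poweR (diameter U) s.

Definition hausdorff_premeasure s delta A : \bar R :=
  ereal_inf [set \sum_(0 <= i <oo) diameter_pow s (U i) |
    U in [set U : nat -> set R |
      A `<=` \bigcup_i U i /\ forall i, diameter (U i) <= delta%:E]].

Definition hausdorff_measure s A : \bar R :=
  ereal_sup [set hausdorff_premeasure s delta A | delta in [set d | (0 < d)%R]].

Definition hausdorff_dim A : \bar R :=
  ereal_inf [set s%:E | s in [set s | (0 <= s)%R /\ hausdorff_measure s A = 0]].

End hausdorff.

(* Main.v *)
(* Keane's four-interval exchanges. The first return map to the fourth interval
   is, with reversed orientation, again an exchange of the same combinatorial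
   type; its return words depend on two integers p_k, q_k chosen at each stage.
   Here the lengths are those for which the third interval carries all but a
   summable part of Lebesgue measure, because q_k is huge. A point outside the
   orbit segments of length H_k through the three other level-k intervals follows
   the third tower during all times between H_(k-1) and H_k, so its Birkhoff averages
   are close to the average along that tower. If this fails for infinitely many k
   then x lies in a limsup of finite unions of very short intervals, whose radii
   are Q_k^-(k+1) while their number is at most Q_k / 2^k: the dimension is 0. The
   same estimate, integrated over an invariant set, gives ergodicity of Lebesgue
   measure. Since p_k is huge too, the second tower spends more than half of its
   time in the second interval at all stages, although that interval has length
   at most 1/4; a limit of averages along the second towers is thus another
   invariant probability. *)
From HB Require Import structures.
Require Import Defs.
From mathcomp Require Import all_boot all_order all_algebra perm.
From mathcomp Require Import all_classical all_reals all_analysis.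
From mathcomp Require Import measurable_realfun.
From mathcomp Require Import zify ring lra.
Set Implicit Arguments.
Unset Strict Implicit.
Unset Printing Implicit Defensive.
Set Bullet Behavior "Strict Subproofs".
Import Order.TTheory GRing.Theory Num.Theory.
Import numFieldNormedType.Exports.
Local Open Scope classical_set_scope.
Local Open Scope ring_scope.

(** The two measures make opposite demands. Time in the second tower requires p_k to dominate q_k,
    whereas p_k copies of the second letter also lengthen the second interval, which is p_k l'_1 +
    (p_k + 1) l'_2 in terms of the next lengths l'. There is no circle because heights are
    determined by the past and lengths by the future: Q_(k+1), chosen after p_k, makes l'_1 and l'_2
    at most l'_3 / Q_(k+1), so the second interval is at most 2 l'_3, negligible next to the third,
    which is at least q_k l'_3. Likewise the number of intervals covering the points that are bad at
    level k depends on the heights of level k alone, that is on earlier stages, so Q_k can exceed it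
    before q_k forces lengths below Q_k^-(k+1). The lengths must solve infinitely many linear
    relations at once; they are a limit of truncated products of matrices, and smallness survives
    the truncation because it is stated as a homogeneous bound relative to the third coordinate. The
    factor k + 1 in H_k makes the excursions outside the third tower an O(1/k) share of the time. *)

Inductive letter := L1 | L2 | L3 | L4.

(** * The induction data *)

(* Level-k intervals visited by the level-(k+1) interval [j] until its return. *)
Definition word (p q : nat) (j : letter) : seq letter :=
  match j with
  | L1 => L4 :: nseq p L2 ++ nseq q.+1 L3
  | L2 => L4 :: nseq p.+1 L2 ++ nseq q.+1 L3
  | L3 => [:: L4, L1 & nseq q L3]
  | L4 => [:: L4, L1 & nseq q.+1 L3]
  end.

(* Transposed incidence matrix of [word]: level-k lengths from level-(k+1) ones. *)
Definition refine {R : ringType} (p q : nat) (l : letter -> R) (i : letter) : R :=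
  match i with
  | L1 => l L3 + l L4
  | L2 => p%:R * l L1 + p.+1%:R * l L2
  | L3 => q.+1%:R * (l L1 + l L2 + l L4) + q%:R * l L3
  | L4 => l L1 + l L2 + l L3 + l L4
  end.

Definition height_sum (h : letter -> nat) : nat := (h L1 + h L2 + h L3 + h L4)%N.

Definition horizon (h : letter -> nat) (k : nat) : nat := (k.+1 * height_sum h)%N.

(* 3 intervals, forwards or backwards, H + 1 times, and at most 4 ^ H possible
   values of the displacement T^i x - x for each i <= H. *)
Definition cover_size (H : nat) : nat := (6 * H.+1 * 4 ^ H)%N.

(* [kh k j] is the return time of the [j]-th level-k interval and [kl k j] its
   length. [kl_small], [kQ_cover] and [kq_large] make the third tower dominate
   Lebesgue measure; [kp_large] makes the second one carry another measure. *)
Record keane (R : realType) := Keane {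
  kp : nat -> nat;
  kq : nat -> nat;
  kQ : nat -> nat;
  kh : nat -> letter -> nat;
  kl : nat -> letter -> R;
  kh0 : forall j, kh 0 j = 1%N;
  khS : forall k j, kh k.+1 j = sumn (map (kh k) (word (kp k) (kq k) j));
  kl_gt0 : forall k j, 0 < kl k j;
  klS : forall k i, kl k i = refine (kp k) (kq k) (kl k.+1) i;
  kl0 : kl 0 L1 + kl 0 L2 + kl 0 L3 + kl 0 L4 = 1;
  kl_small : forall k j, j <> L3 -> kl k j <= (kQ k)%:R ^- k.+1;
  kQ_ge4 : forall k, (4 <= kQ k)%N;
  kQ_cover : forall k, (2 ^ k * cover_size (horizon (kh k) k) <= kQ k)%N;
  kq_large : forall k, (horizon (kh k) k <= kq k)%N;
  kp_large : forall k,
    (2 ^ k.+2 * (kh k L4 + (kq k).+1 * kh k L3) <= kp k * kh k L2)%N;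
}.

(* Membership in the half-open interval between the coordinates [p] and [q] of
   an axis with origin [e], directed to the right iff [s]. The interval stays
   closed on its left end, whatever the direction. *)
Definition in_itv_dir {R : realType} (s : bool) (e p q x : R) : bool :=
  if s then e + p <= x < e + q else e - q <= x < e - p.

Definition dir {R : realType} (s : bool) : R := if s then 1 else -1.

(** * Intervals on an oriented axis *)

Section in_itv_dir.
Context {R : realType}.
Implicit Types (s : bool) (e p q r t x : R).

Lemma in_itv_dir_shift s e p q t p' q' x : in_itv_dir s e p q x ->
  p' <= p + t -> q + t <= q' -> in_itv_dir s e p' q' (x + dir s * t).
Proof. by rewrite /in_itv_dir /dir; case: s; lra. Qed.

Lemma in_itv_dir_sub s e p q p' q' x : in_itv_dir s e p q x ->
  p' <= p -> q <= q' -> in_itv_dir s e p' q' x.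
Proof. by rewrite /in_itv_dir /dir; case: s; lra. Qed.

(** Moving the origin to [t] and reversing the axis turns a coordinate [c] into [t - c]. The
    half-open convention survives because the left end is the closed one in both directions. *)
Lemma in_itv_dir_flip s e t p q x :
  in_itv_dir (~~ s) (e + dir s * t) p q x = in_itv_dir s e (t - q) (t - p) x.
Proof. by rewrite /in_itv_dir /dir; case: s => /=; apply/idP/idP; lra. Qed.

Lemma in_itv_dir_split s e p q r x : in_itv_dir s e p r x ->
  in_itv_dir s e p q x \/ in_itv_dir s e q r x.
Proof. by rewrite /in_itv_dir; case: s; case: (ltP x (e + q)); case: (ltP x (e - q)); lra. Qed.

Lemma in_itv_dir_dist s e p q x y : in_itv_dir s e p q x -> in_itv_dir s e p q y ->
  `|x - y| <= q - p.
Proof. by rewrite ler_norml /in_itv_dir; case: s; lra. Qed.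

Lemma in_itv_dir_run s e p t n x : 0 <= t -> in_itv_dir s e p (p + n%:R * t) x ->
  exists2 i, (i < n)%N & in_itv_dir s e (p + i%:R * t) (p + i.+1%:R * t) x.
Proof.
move=> t0; elim: n => [|n IHn]; first by rewrite /in_itv_dir; case: s; lra.
move=> /(@in_itv_dir_split _ _ _ (p + n%:R * t))[/IHn[i ltin Hi]|Hx].
  by exists i => //; exact: ltnW.
by exists n.
Qed.

End in_itv_dir.

(** * The exchange, its nested sections and their orientation *)

Section keane_map.
Context {R : realType} (D : keane R).
Implicit Types (k n : nat) (j : letter) (w : seq letter) (x y : R).

Definition lft k j : R :=
  match j with
  | L1 => 0 | L2 => kl D k L1 | L3 => kl D k L1 + kl D k L2
  | L4 => kl D k L1 + kl D k L2 + kl D k L3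
  end.

Definition tot k : R := kl D k L1 + kl D k L2 + kl D k L3 + kl D k L4.

(* Displacements when the images are ordered as I_4, I_2, I_1, I_3. *)
Definition tau k j : R :=
  match j with
  | L1 => kl D k L4 + kl D k L2 | L2 => kl D k L4 - kl D k L1
  | L3 => kl D k L4 | L4 => - (kl D k L1 + kl D k L2 + kl D k L3)
  end.

Definition ori k : bool := ~~ odd k.

(** Level [k.+1] is read backwards from the far end of the level-k section, where the fourth
    interval lies. *)
Fixpoint base k : R := if k is k'.+1 then base k' + dir (ori k') * tot k' else 0.

Definition piece k j x : bool :=
  in_itv_dir (ori k) (base k) (lft k j) (lft k j + kl D k j) x.

Definition section k x : bool := in_itv_dir (ori k) (base k) 0 (tot k) x.

Definition step j x : R := x + tau 0 j.

(** Outside [0, 1) the first and last translations are continued, so every step on the line is one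
    of the four displacements; [iter_shifts] relies on this. *)
Definition ket x : R :=
  if x < lft 0 L2 then step L1 x
  else if x < lft 0 L3 then step L2 x
  else if x < lft 0 L4 then step L3 x else step L4 x.

Notation T := ket.
Notation h := (kh D).

Definition wsum k w : nat := sumn (map (h k) w).

(* From [x], the level-k return map reads the letters of [w] and arrives at [y]. *)
Fixpoint path k w x y : Prop :=
  if w is j :: w' then piece k j x /\ path k w' (iter (h k j) T x) y else x = y.

Lemma kl_gt0s k : [/\ 0 < kl D k L1, 0 < kl D k L2, 0 < kl D k L3 & 0 < kl D k L4].
Proof. by split; exact: kl_gt0. Qed.

Lemma piece_section k j x : piece k j x -> section k x.
Proof.
have [g1 g2 g3 g4] := kl_gt0s k.
by move=> H; apply: (in_itv_dir_sub H); case: j {H}; rewrite /= /tot; lra.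
Qed.

Lemma section_piece k x : section k x -> exists j, piece k j x.
Proof.
have E (p p' q q' : R) : in_itv_dir (ori k) (base k) p q x -> p = p' -> q = q' ->
  in_itv_dir (ori k) (base k) p' q' x by move=> ? <- <-.
move=> /(@in_itv_dir_split _ _ _ _ (lft k L4))[|H].
  move=> /(@in_itv_dir_split _ _ _ _ (lft k L3))[|H].
    move=> /(@in_itv_dir_split _ _ _ _ (lft k L2))[|] H.
      by exists L1; apply: (E _ _ _ _ H) => //=; ring.
    by exists L2; apply: (E _ _ _ _ H) => //=; ring.
  by exists L3; apply: (E _ _ _ _ H) => //=; ring.
by exists L4; apply: (E _ _ _ _ H) => //=; rewrite /tot; ring.
Qed.

Lemma section_tau k j x : piece k j x -> section k (x + dir (ori k) * tau k j).
Proof.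
have [g1 g2 g3 g4] := kl_gt0s k.
have e1 := klS D k L1; have e4 := klS D k L4; rewrite /= in e1 e4.
have [g1' g2' _ _] := kl_gt0s k.+1.
by move=> H; apply: (in_itv_dir_shift H); case: j {H}; rewrite /= /tot; lra.
Qed.

Lemma ket_piece j x : piece 0 j x -> T x = x + tau 0 j.
Proof.
have [g1 g2 g3 g4] := kl_gt0s 0.
rewrite /piece /in_itv_dir /ket /step [ori 0]/= [base 0]/= => Hx.
have nlt (y z : R) : z <= y -> (y < z) = false by move=> zy; rewrite ltNge zy.
case: j Hx => /= /andP[H1 H2].
- by rewrite ifT //; lra.
- by rewrite ifF ?ifT //; first [lra|apply: nlt; lra].
- rewrite (nlt x (kl D 0 L1)); last by lra.
  by rewrite (nlt x (_ + _)) ?ifT //; lra.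
- rewrite (nlt x (kl D 0 L1)); last by lra.
  rewrite (nlt x (kl D 0 L1 + kl D 0 L2)); last by lra.
  by rewrite nlt //; lra.
Qed.

Lemma path_cat k w1 w2 x y z : path k w1 x y -> path k w2 y z -> path k (w1 ++ w2) x z.
Proof.
elim: w1 x => [x /= -> //|j w1 IHw x] /= [jx p1 p2]; split=> //; exact: IHw p1 p2.
Qed.

Lemma path_iter k w x y : path k w x y -> iter (wsum k w) T x = y.
Proof.
elim: w x => [x //|j w IHw x] /= [jx /IHw <-].
by rewrite /wsum /= addnC iterD.
Qed.

End keane_map.

(** * Return words of the induced exchanges *)

Section keane_induction.
Context {R : realType} (D : keane R).
Implicit Types (k n : nat) (j : letter) (w : seq letter) (x y : R).

Notation T := (ket D).
Notation h := (kh D).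
Notation l := (kl D).

Definition returns k : Prop :=
  forall j x, piece D k j x -> iter (h k j) T x = x + dir (ori k) * tau D k j.

(* The coordinates [P], [Q] and the displacement [t] are along the level-k axis. *)
Definition ipath k w (P Q t : R) : Prop := forall x,
  in_itv_dir (ori k) (base D k) P Q x -> path D k w x (x + dir (ori k) * t).

Lemma ipath_cat k w1 w2 P Q t1 t2 :
  ipath k w1 P Q t1 -> ipath k w2 (P + t1) (Q + t1) t2 ->
  ipath k (w1 ++ w2) P Q (t1 + t2).
Proof.
move=> p1 p2 x Hx; apply: path_cat (p1 _ Hx) _.
rewrite mulrDr addrA; apply: p2.
exact: (in_itv_dir_shift Hx).
Qed.

Lemma ipath1 k j P Q : returns k -> lft D k j <= P -> Q <= lft D k j + l k j ->
  ipath k [:: j] P Q (tau D k j).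
Proof.
move=> rk lP Qr x Hx; have jx : piece D k j x by apply: (in_itv_dir_sub Hx).
by split=> //=; exact: rk.
Qed.

(** As the displacement is nonnegative, only the left end of the first visit and the right end of
    the last one can leave the piece. The latter, [Q + (n - 1) * tau], appears with one more [tau]
    on both sides to avoid the predecessor. *)
Lemma ipath_nseq k j n P Q : returns k -> 0 <= tau D k j -> lft D k j <= P ->
  Q + n%:R * tau D k j <= lft D k j + l k j + tau D k j ->
  ipath k (nseq n j) P Q (n%:R * tau D k j).
Proof.
move=> rk t0; elim: n P Q => [|n IHn] P Q lP Qr x Hx.
  by rewrite /= mul0r mulr0 addr0.
have n0 : 0 <= n%:R * tau D k j by rewrite mulr_ge0.
rewrite -nat1r in Qr *.
have -> : (1 + n%:R) * tau D k j = tau D k j + n%:R * tau D k j :> R by ring.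
apply: (@ipath_cat k [:: j] (nseq n j) P Q) Hx; first by apply: ipath1 => //; lra.
by apply: IHn; lra.
Qed.

Lemma ipath_eq k w P Q t t' : ipath k w P Q t -> t = t' -> ipath k w P Q t'.
Proof. by move=> H <-. Qed.

Lemma piece_flip k j x : piece D k.+1 j x =
  in_itv_dir (ori k) (base D k) (tot D k - (lft D k.+1 j + l k.+1 j))
    (tot D k - lft D k.+1 j) x.
Proof. by rewrite -in_itv_dir_flip. Qed.

(** The sign of the displacement reflects the reversal of the axis. The repeated letters move
    forwards, since [tau D k L2 = l k.+1 L1 + l k.+1 L2] and [tau D k L3 = l k L4]; once lengths are
    expressed at level [k.+1], each condition is a linear inequality. *)
Lemma ipath_word k j : returns k ->
  ipath k (word (kp D k) (kq D k) j) (tot D k - (lft D k.+1 j + l k.+1 j))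
    (tot D k - lft D k.+1 j) (- tau D k.+1 j).
Proof.
move=> rk.
have [g1 g2 g3 g4] := kl_gt0s D k.
have [g1' g2' g3' g4'] := kl_gt0s D k.+1.
have e1 := klS D k L1; have e2 := klS D k L2; have e3 := klS D k L3; have e4 := klS D k L4.
rewrite /= in e1 e2 e3 e4.
have t2 : 0 <= tau D k L2 by rewrite /=; lra.
have t3 : 0 <= tau D k L3 by rewrite /=; lra.
set p := kp D k in e2 *; set q := kq D k in e3 *.
rewrite -!(nat1r p) in e2; rewrite -!(nat1r q) in e3.
(* Products with [p] and [q] are opaque to [lra]: the signs that it needs are supplied in expanded
   form. *)
have q0 : 0 <= q%:R * l k L4 by rewrite mulr_ge0 // ltW.
have p0 : 0 <= p%:R * tau D k L2 by rewrite mulr_ge0.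
rewrite e4 in q0; rewrite /= e4 e1 in p0.
case: j; rewrite /word.
- rewrite -cat1s; apply: ipath_eq (ipath_cat (ipath1 _ _ _)
   (ipath_cat (ipath_nseq _ _ _ _) (ipath_nseq _ _ _ _))) _ => //;
  by rewrite /= -?(nat1r q) ?e1 ?e2 ?e3 ?e4 /tot ?e1 ?e2 ?e3 ?e4; lra.
- rewrite -cat1s; apply: ipath_eq (ipath_cat (ipath1 _ _ _)
   (ipath_cat (ipath_nseq _ _ _ _) (ipath_nseq _ _ _ _))) _ => //;
  by rewrite /= -?(nat1r q) -?(nat1r p) ?e1 ?e2 ?e3 ?e4 /tot ?e1 ?e2 ?e3 ?e4; lra.
- rewrite -cat1s -(cat1s L1); apply: ipath_eq (ipath_cat (ipath1 _ _ _)
   (ipath_cat (ipath1 _ _ _) (ipath_nseq _ _ _ _))) _ => //;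
  by rewrite /= -?(nat1r q) -?(nat1r p) ?e1 ?e2 ?e3 ?e4 /tot ?e1 ?e2 ?e3 ?e4; lra.
- rewrite -cat1s -(cat1s L1); apply: ipath_eq (ipath_cat (ipath1 _ _ _)
   (ipath_cat (ipath1 _ _ _) (ipath_nseq _ _ _ _))) _ => //;
  by rewrite /= -?(nat1r q) -?(nat1r p) ?e1 ?e2 ?e3 ?e4 /tot ?e1 ?e2 ?e3 ?e4; lra.
Qed.

End keane_induction.

Lemma nseq_split (A : Type) (x : A) i n : (i < n)%N ->
  nseq n x = nseq i x ++ x :: nseq (n - i.+1) x.
Proof. by move=> /subnKC {1}<-; rewrite addSnnS nseqD. Qed.

(** * Exhaustion of each level by the orbits of the next *)

Section keane_cover.
Context {R : realType} (D : keane R).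
Implicit Types (i k n : nat) (j : letter) (w : seq letter) (x y : R).

Notation T := (ket D).
Notation h := (kh D).
Notation l := (kl D).

Lemma returnsP k : returns D k.
Proof.
elim: k => [|k rk] j x; first by move=> /ket_piece; rewrite kh0 mul1r.
rewrite piece_flip => /(ipath_word rk) /path_iter.
rewrite /wsum -khS => ->.
by rewrite /ori /= /dir; case: (odd k); rewrite /= ?mul1r ?mulN1r ?opprK.
Qed.

Lemma path_word k j x : piece D k.+1 j x ->
  path D k (word (kp D k) (kq D k) j) x (iter (h k.+1 j) T x).
Proof.
rewrite piece_flip => /(ipath_word (@returnsP k)) pk.
by rewrite khS (path_iter pk).
Qed.

Lemma section_return k j x : piece D k j x -> section D k (iter (h k j) T x).
Proof. by move=> jx; rewrite returnsP //; exact: section_tau. Qed.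

Lemma section_sub k x : section D k.+1 x -> piece D k L4 x.
Proof.
rewrite /section -/(ori k.+1) in_itv_dir_flip => H.
apply: (in_itv_dir_sub H); rewrite /= /tot ?subrr ?subr0 //.
have := klS D k L4; rewrite /= => ->; lra.
Qed.

(* [y] lies on the orbit of some level-(k+1) interval, at a letter [j] of its word. *)
Definition reached k j y : Prop := exists j' w1 w2 x,
  [/\ piece D k.+1 j' x, word (kp D k) (kq D k) j' = w1 ++ j :: w2 & path D k w1 x y].

Lemma reached_intro k j y (p q : R) j' w1 w2 t :
  in_itv_dir (ori k) (base D k) p q y ->
  word (kp D k) (kq D k) j' = w1 ++ j :: w2 ->
  ipath D k w1 (tot D k - (lft D k.+1 j' + l k.+1 j')) (tot D k - lft D k.+1 j') t ->
  tot D k - (lft D k.+1 j' + l k.+1 j') + t <= p ->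
  q <= tot D k - lft D k.+1 j' + t ->
  reached k j y.
Proof.
move=> Hy E I1 lp qr; exists j', w1, w2, (y + dir (ori k) * - t).
have Hx : in_itv_dir (ori k) (base D k) (tot D k - (lft D k.+1 j' + l k.+1 j'))
     (tot D k - lft D k.+1 j') (y + dir (ori k) * - t).
  by apply: (in_itv_dir_shift Hy); lra.
split=> //; first by rewrite piece_flip.
by have := I1 _ Hx; rewrite mulrN subrK.
Qed.

Lemma ipath_nil k P Q : ipath D k [::] P Q 0.
Proof. by move=> x _; rewrite /= mulr0 addr0. Qed.

(** Each piece is tiled by images of level-(k+1) pieces, of widths l', in the following order: l'_4,
    l'_3 for the first; p cells l'_2, l'_1 and a final l'_2 for the second; q cells l'_1, l'_2,
    l'_4, l'_3 and a final l'_1, l'_2, l'_4 for the third; l'_4, l'_3, l'_2, l'_1 for the fourth.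
    That these widths add up is [klS]. *)
Lemma piece_reached k j y : piece D k j y -> reached k j y.
Proof.
have rk := @returnsP k.
have [g1 g2 g3 g4] := kl_gt0s D k.
have [g1' g2' g3' g4'] := kl_gt0s D k.+1.
have e1 := klS D k L1; have e2 := klS D k L2; have e3 := klS D k L3; have e4 := klS D k L4.
rewrite /= in e1 e2 e3 e4.
have t2 : 0 <= tau D k L2 by rewrite /=; lra.
have t3 : 0 <= tau D k L3 by rewrite /=; lra.
rewrite -!(nat1r (kp D k)) in e2; rewrite -!(nat1r (kq D k)) in e3.
have p0 : 0 <= (kp D k)%:R * tau D k L2 by rewrite mulr_ge0.
rewrite /= e4 e1 in p0.
have s := (e1, e2, e3, e4).
case: j => Hy.
- have {Hy} [] := in_itv_dir_split (l k.+1 L4) Hy => Hy.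
  + apply: (reached_intro (j' := L4) (w1 := [:: L4]) Hy) => //.
      by apply: ipath1 => //; rewrite /= /tot ?s; lra.
    all: by rewrite /= /tot ?s; lra.
  + apply: (reached_intro (j' := L3) (w1 := [:: L4]) Hy) => //.
      by apply: ipath1 => //; rewrite /= /tot ?s; lra.
    all: by rewrite /= /tot ?s; lra.
- have H1 i : (i < kp D k)%N ->
      ipath D k (L4 :: nseq i L2) (tot D k - (lft D k.+1 L1 + l k.+1 L1))
      (tot D k - lft D k.+1 L1) (tau D k L4 + i%:R * tau D k L2).
    move=> ip; rewrite -cat1s; apply: ipath_cat.
      by apply: ipath1 => //; rewrite /= /tot ?s; lra.
    have := ler_wpM2r t2 (_ : i.+1%:R <= (kp D k)%:R :> R); rewrite ler_nat => /(_ ip).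
    by move=> B; apply: ipath_nseq => //; move: B; rewrite -?(nat1r i) /= /tot ?s; lra.
  have H2 i : (i <= kp D k)%N ->
      ipath D k (L4 :: nseq i L2) (tot D k - (lft D k.+1 L2 + l k.+1 L2))
      (tot D k - lft D k.+1 L2) (tau D k L4 + i%:R * tau D k L2).
    move=> ip; rewrite -cat1s; apply: ipath_cat.
      by apply: ipath1 => //; rewrite /= /tot ?s; lra.
    have := ler_wpM2r t2 (_ : i%:R <= (kp D k)%:R :> R); rewrite ler_nat => /(_ ip).
    by move=> B; apply: ipath_nseq => //; move: B; rewrite /= /tot ?s; lra.
  have {Hy} [] := in_itv_dir_split (l k L1 + (kp D k)%:R * tau D k L2) Hy => Hy; last first.
  { apply: (reached_intro (j' := L2) Hy _ (H2 _ (leqnn _))).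
      by rewrite /word (@nseq_split _ _ (kp D k) (kp D k).+1) // cat_cons -catA.
    all: by rewrite /= /tot ?s; lra. }
  have [i ip {}Hy] := in_itv_dir_run t2 Hy.
  have {Hy} [] := in_itv_dir_split (l k L1 + i%:R * tau D k L2 + l k.+1 L2) Hy => Hy.
    + apply: (reached_intro (j' := L2) Hy _ (H2 _ (ltnW ip))).
        by rewrite /word (@nseq_split _ _ i (kp D k).+1) ?ltnS ?(ltnW ip) // cat_cons -catA.
      all: by rewrite -?(nat1r i) /= /tot ?s; lra.
    + apply: (reached_intro (j' := L1) Hy _ (H1 _ ip)).
        by rewrite /word (@nseq_split _ _ i (kp D k)) // cat_cons -catA.
      all: by rewrite -?(nat1r i) /= /tot ?s; lra.
- have HA i : (i <= kq D k)%N ->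
      ipath D k (L4 :: nseq (kp D k) L2 ++ nseq i L3)
      (tot D k - (lft D k.+1 L1 + l k.+1 L1)) (tot D k - lft D k.+1 L1)
      (tau D k L4 + ((kp D k)%:R * tau D k L2 + i%:R * tau D k L3)).
    { move=> iq; rewrite -cat1s; apply: ipath_cat; last apply: ipath_cat.
    + by apply: ipath1 => //; rewrite /= /tot ?s; lra.
    + by apply: ipath_nseq => //; rewrite /= /tot ?s; lra.
    + have := ler_wpM2r t3 (_ : i%:R <= (kq D k)%:R :> R); rewrite ler_nat => /(_ iq).
      by move=> B; apply: ipath_nseq => //; move: B; rewrite /= /tot ?s; lra. }
  have HB i : (i <= kq D k)%N ->
      ipath D k (L4 :: nseq (kp D k).+1 L2 ++ nseq i L3)
      (tot D k - (lft D k.+1 L2 + l k.+1 L2)) (tot D k - lft D k.+1 L2)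
      (tau D k L4 + ((kp D k).+1%:R * tau D k L2 + i%:R * tau D k L3)).
    { move=> iq; rewrite -cat1s; apply: ipath_cat; last apply: ipath_cat.
    + by apply: ipath1 => //; rewrite /= /tot ?s; lra.
    + by apply: ipath_nseq => //; rewrite -?(nat1r (kp D k)) /= /tot ?s; lra.
    + have := ler_wpM2r t3 (_ : i%:R <= (kq D k)%:R :> R); rewrite ler_nat => /(_ iq).
      move=> B; apply: ipath_nseq => //; move: B; rewrite -?(nat1r (kp D k)) /= /tot ?s; lra. }
  have HC i : (i < kq D k)%N ->
      ipath D k [:: L4, L1 & nseq i L3]
      (tot D k - (lft D k.+1 L3 + l k.+1 L3)) (tot D k - lft D k.+1 L3)
      (tau D k L4 + (tau D k L1 + i%:R * tau D k L3)).
    { move=> iq; rewrite -cat1s -(cat1s L1); apply: ipath_cat; last apply: ipath_cat.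
    + by apply: ipath1 => //; rewrite /= /tot ?s; lra.
    + by apply: ipath1 => //; rewrite /= /tot ?s; lra.
    + have := ler_wpM2r t3 (_ : i.+1%:R <= (kq D k)%:R :> R); rewrite ler_nat => /(_ iq).
      by move=> B; apply: ipath_nseq => //; move: B; rewrite -?(nat1r i) /= /tot ?s; lra. }
  have HD i : (i <= kq D k)%N ->
      ipath D k [:: L4, L1 & nseq i L3]
      (tot D k - (lft D k.+1 L4 + l k.+1 L4)) (tot D k - lft D k.+1 L4)
      (tau D k L4 + (tau D k L1 + i%:R * tau D k L3)).
    { move=> iq; rewrite -cat1s -(cat1s L1); apply: ipath_cat; last apply: ipath_cat.
    + by apply: ipath1 => //; rewrite /= /tot ?s; lra.
    + by apply: ipath1 => //; rewrite /= /tot ?s; lra.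
    + have := ler_wpM2r t3 (_ : i%:R <= (kq D k)%:R :> R); rewrite ler_nat => /(_ iq).
      by move=> B; apply: ipath_nseq => //; move: B; rewrite /= /tot ?s; lra. }
  (* [r] is the width of the [i]-th cell: a full displacement [tau D k L3], except in the last cell,
     which lacks the part of width [l k.+1 L3]. *)
  have main i (r : R) : (i <= kq D k)%N ->
      r = (if i == kq D k then l k.+1 L1 + l k.+1 L2 + l k.+1 L4 else tau D k L3) ->
      in_itv_dir (ori k) (base D k) (lft D k L3 + i%:R * tau D k L3)
        (lft D k L3 + i%:R * tau D k L3 + r) y -> reached k L3 y.
    { move=> iq rE {}Hy.
    have {Hy} [] := in_itv_dir_split (lft D k L3 + i%:R * tau D k L3 + l k.+1 L1) Hy => Hy.
    { apply: (reached_intro (j' := L1) Hy _ (HA i iq)).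
        by rewrite /word (@nseq_split _ _ i (kq D k).+1) // cat_cons -catA.
      all: by rewrite /= /tot ?s; lra. }
    have {Hy} [] := in_itv_dir_split (lft D k L3 + i%:R * tau D k L3 +
        (l k.+1 L1 + l k.+1 L2)) Hy => Hy.
    { apply: (reached_intro (j' := L2) Hy _ (HB i iq)).
        by rewrite /word (@nseq_split _ _ i (kq D k).+1) // cat_cons -catA.
      all: by rewrite -?(nat1r (kp D k)) /= /tot ?s; lra. }
    have {Hy} [] := in_itv_dir_split (lft D k L3 + i%:R * tau D k L3 +
        (l k.+1 L1 + l k.+1 L2 + l k.+1 L4)) Hy => Hy.
    { apply: (reached_intro (j' := L4) Hy _ (HD i iq)).
        by rewrite /word (@nseq_split _ _ i (kq D k).+1) // cat_cons -catA.
      all: by rewrite /= /tot ?s; lra. }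
    have [ik|ik] := eqVneq i (kq D k); rewrite ?ik ?eqxx ?(negbTE ik) in rE.
      by move: Hy; rewrite rE /in_itv_dir; case: (ori k); lra.
    have {}iq : (i < kq D k)%N by rewrite ltn_neqAle ik.
    apply: (reached_intro (j' := L3) Hy _ (HC i iq)).
      by rewrite /word (@nseq_split _ _ i (kq D k)) // cat_cons -catA.
    all: by rewrite ?rE /= /tot ?s; lra. }
  have {Hy} [] := in_itv_dir_split (lft D k L3 + (kq D k)%:R * tau D k L3) Hy => Hy.
    have [i iq {}Hy] := in_itv_dir_run t3 Hy.
    apply: (main i _ (ltnW iq) (erefl _)).
    by rewrite ltn_eqF //; apply: (in_itv_dir_sub Hy); rewrite -?(nat1r i) /=; lra.
  apply: (main (kq D k) _ (leqnn _) (erefl _)).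
  by rewrite eqxx; apply: (in_itv_dir_sub Hy); rewrite /= ?s; lra.
- have {Hy} [] := in_itv_dir_split (lft D k L4 + l k L1) Hy => Hy.
  { have {Hy} [] := in_itv_dir_split (lft D k L4 + l k.+1 L4) Hy => Hy.
    + apply: (reached_intro (j' := L4) (w1 := [::]) Hy) => //; first exact: ipath_nil.
      all: by rewrite /= /tot ?s; lra.
    + apply: (reached_intro (j' := L3) (w1 := [::]) Hy) => //; first exact: ipath_nil.
      all: by rewrite /= /tot ?s; lra. }
  have {Hy} [] := in_itv_dir_split (lft D k L4 + l k L1 + l k.+1 L2) Hy => Hy.
  + apply: (reached_intro (j' := L2) (w1 := [::]) Hy) => //; first exact: ipath_nil.
    all: by rewrite /= /tot ?s; lra.
  + apply: (reached_intro (j' := L1) (w1 := [::]) Hy) => //; first exact: ipath_nil.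
    all: by rewrite /= /tot ?s; lra.
Qed.

End keane_cover.

(** * Minimality *)

Section keane_minimal.
Context {R : realType} (D : keane R).
Implicit Types (i k n t : nat) (j : letter) (w : seq letter) (x y z : R).

Notation T := (ket D).
Notation h := (kh D).
Notation l := (kl D).

Definition rho k : R := (kQ D k)%:R ^- k.+1.

Lemma rho_gt0 k : 0 < rho k.
Proof. by rewrite invr_gt0 exprn_gt0 // ltr0n (leq_trans _ (kQ_ge4 D k)). Qed.

Lemma rho_le k : rho k <= k.+1%:R^-1.
Proof.
rewrite /rho -natrX lef_pV2 ?posrE ?ltr0n ?expn_gt0 ?(leq_trans _ (kQ_ge4 D k)) //.
rewrite ler_nat (leq_trans (ltnW (ltn_expl k.+1 (isT : 1 < 4)%N))) //.
by rewrite leq_exp2r // kQ_ge4.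
Qed.

Lemma totS k : tot D k.+1 = l k L4.
Proof. by rewrite (klS D k L4). Qed.

Lemma totS_le k : tot D k.+1 <= k.+1%:R^-1.
Proof. by rewrite totS (le_trans _ (rho_le k)) // kl_small. Qed.

Lemma kl_le_tot k j : l k j <= tot D k.
Proof.
have [g1 g2 g3 g4] := kl_gt0s D k.
by case: j; rewrite /tot; lra.
Qed.

Lemma section0E x : section D 0 x = (0 <= x < 1).
Proof. by rewrite /section /in_itv_dir /= /tot kl0 !add0r. Qed.

Lemma kh_gt0 k j : (0 < h k j)%N.
Proof.
elim: k j => [|k IHk] j; first by rewrite kh0.
by rewrite khS; case: j => /=; rewrite addn_gt0 IHk.
Qed.

Lemma kq_gt0 k : (0 < kq D k)%N.
Proof.
rewrite (leq_trans _ (kq_large D k)) // muln_gt0 /= /height_sum.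
by rewrite !addn_gt0 kh_gt0.
Qed.

Lemma kp_gt0 k : (0 < kp D k)%N.
Proof.
have : (0 < kp D k * h k L2)%N.
  rewrite (leq_trans _ (kp_large D k)) //.
  by rewrite muln_gt0 expn_gt0 /= addn_gt0 kh_gt0.
by rewrite muln_gt0 => /andP[].
Qed.

Lemma covered k x : 0 <= x < 1 ->
  exists j y i, [/\ piece D k j y, (i < h k j)%N & iter i T y = x].
Proof.
move=> x01; elim: k => [|k [j [y [i [jy ij iy]]]]].
  have /section_piece[j jx] : section D 0 x by rewrite section0E.
  by exists j, x, 0%N; rewrite kh0.
have [j' [w1 [w2 [z [jz Ew pz]]]]] := piece_reached jy.
exists j', z, (i + wsum D k w1)%N; split=> //; last by rewrite iterD (path_iter pz).
rewrite khS Ew map_cat sumn_cat /= /wsum addnC ltn_add2l.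
exact: leq_trans ij (leq_addr _ _).
Qed.

Lemma ket_itv x : 0 <= x < 1 -> 0 <= T x < 1.
Proof.
rewrite -!section0E => /section_piece[j jx].
by have := section_return jx; rewrite kh0.
Qed.

Lemma iter_ket_itv n x : 0 <= x < 1 -> 0 <= iter n T x < 1.
Proof. by move=> x01; elim: n => //= n; exact: ket_itv. Qed.

Lemma section_itv k x : section D k x -> 0 <= x < 1.
Proof.
elim: k => [|k IHk]; first by rewrite section0E.
by move/section_sub/piece_section/IHk.
Qed.

Lemma piece_itv k j x : piece D k j x -> 0 <= x < 1.
Proof. by move/piece_section/section_itv. Qed.

Lemma path_shift k w x x' y y' t :
  (forall j i z z', piece D k j z -> piece D k j z' -> (i <= h k j)%N ->
    iter i T z - z = iter i T z' - z') ->
  path D k w x x' -> path D k w y y' -> (t <= wsum D k w)%N ->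
  iter t T x - x = iter t T y - y.
Proof.
move=> Hk; elim: w x y t => [|j w IHw] x y t.
  by rewrite /wsum leqn0 => _ _ /eqP -> /=; rewrite !subrr.
move=> /= [jx px] [jy py]; rewrite /wsum /= => tw.
have [tj|jt] := leqP t (h k j); first exact: Hk tj.
rewrite -(subnK (ltnW jt)) !iterD.
have := IHw _ _ (t - h k j)%N px py.
rewrite leq_subLR => /(_ tw) E.
have E' := Hk j (h k j) x y jx jy (leqnn _).
by apply/eqP; rewrite -subr_eq0; apply/eqP; lra.
Qed.

(** Points of one piece read the same words at all lower levels, so they undergo the same
    translations until their return. *)
Lemma level_shift k j i x y : piece D k j x -> piece D k j y -> (i <= h k j)%N ->
  iter i T x - x = iter i T y - y.
Proof.
elim: k j i x y => [|k IHk] j i x y jx jy.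
  rewrite kh0; case: i => [_|[_|//]] /=; first by rewrite !subrr.
  by rewrite !(@ket_piece _ _ j) // !(addrC _ (tau _ _ _)) !addrK.
rewrite khS => ij.
exact: path_shift IHk (path_word jx) (path_word jy) ij.
Qed.

Definition visits k j x : Prop := exists t, piece D k j (iter t T x).

Lemma path_split k w1 w2 x y : path D k (w1 ++ w2) x y ->
  path D k w1 x (iter (wsum D k w1) T x) /\
  path D k w2 (iter (wsum D k w1) T x) y.
Proof.
elim: w1 x => [x //|j w1 IHw x] /= [jx /IHw[p1 p2]].
by rewrite /wsum /= (addnC (h k j)) iterD; split.
Qed.

Lemma visits_word k j j' w1 w2 x : word (kp D k) (kq D k) j' = w1 ++ j :: w2 ->
  visits k.+1 j' x -> visits k j x.
Proof.
move=> Ew [t /path_word]; rewrite Ew => /path_split[_ [jx _]].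
by exists (wsum D k w1 + t)%N; rewrite iterD.
Qed.

Lemma visits_L3 k j x : visits k.+1 j x -> visits k L3 x.
Proof.
case: j.
- by apply: (@visits_word _ _ _ (L4 :: nseq (kp D k) L2) (nseq (kq D k) L3)).
- by apply: (@visits_word _ _ _ (L4 :: nseq (kp D k).+1 L2) (nseq (kq D k) L3)).
- apply: (@visits_word _ _ _ [:: L4; L1] (nseq (kq D k).-1 L3)).
  by rewrite /= -[in LHS](prednK (kq_gt0 k)).
- by apply: (@visits_word _ _ _ [:: L4; L1] (nseq (kq D k) L3)).
Qed.

Lemma visits_L4 k j x : visits k.+1 j x -> visits k L4 x.
Proof.
case: j.
- by apply: (@visits_word _ _ _ [::] (nseq (kp D k) L2 ++ nseq (kq D k).+1 L3)).
- by apply: (@visits_word _ _ _ [::] (nseq (kp D k).+1 L2 ++ nseq (kq D k).+1 L3)).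
- by apply: (@visits_word _ _ _ [::] (L1 :: nseq (kq D k) L3)).
- by apply: (@visits_word _ _ _ [::] (L1 :: nseq (kq D k).+1 L3)).
Qed.

Lemma visits_L1 k x : visits k.+1 L3 x -> visits k L1 x.
Proof. by apply: (@visits_word _ _ _ [:: L4] (nseq (kq D k) L3)). Qed.

(** Two levels are needed: only the words of [L1] and [L2] contain [L2], but those of [L3] and [L4]
    contain [L1]. *)
Lemma visits_L2 k j x : visits k.+2 j x -> visits k L2 x.
Proof.
have L1L2 : visits k.+1 L1 x -> visits k L2 x.
  apply: (@visits_word _ _ _ [:: L4] (nseq (kp D k).-1 L2 ++ nseq (kq D k).+1 L3)).
  by rewrite /= -[in LHS](prednK (kp_gt0 k)).
have L2L2 k' : visits k'.+1 L2 x -> visits k' L2 x.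
  by apply: (@visits_word _ _ _ [:: L4] (nseq (kp D k') L2 ++ nseq (kq D k').+1 L3)).
case: j.
- move=> H; apply: L2L2; move: H.
  apply: (@visits_word _ _ _ [:: L4] (nseq (kp D k.+1).-1 L2 ++ nseq (kq D k.+1).+1 L3)).
  by rewrite /= -[in LHS](prednK (kp_gt0 k.+1)).
- by move=> /L2L2/L2L2.
- by move=> H; apply/L1L2/visits_L1.
- move=> H; apply: L1L2; move: H.
  by apply: (@visits_word _ _ _ [:: L4] (nseq (kq D k.+1).+1 L3)).
Qed.

Lemma visits_all k j x : 0 <= x < 1 -> visits k j x.
Proof.
move=> x01.
have [j' Hj'] : exists j', visits k.+2 j' x.
  have [j' [y [i [jy ij iy]]]] := covered k.+2 x01.
  have /section_piece[j2 H2] := section_return jy.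
  exists j2, (h k.+2 j' - i)%N.
  by rewrite -iy -iterD subnK // ltnW.
have H3 := visits_L3 Hj'.
case: j.
- exact: visits_L1.
- exact: visits_L2 Hj'.
- exact: visits_L3 H3.
- exact: visits_L4 H3.
Qed.

(** The orbit of [x] enters the base of the tower through [z]. While it climbs to the height of [z],
    its distance to the orbit leading to [z] is constant, hence at most the length of the base. *)
Lemma ket_minimal : minimal_map T.
Proof.
move=> x; rewrite in_itv /= => x01 z; rewrite /= in_itv /= => z01 B /nbhs_ballP[e e0 HB].
have [k ke] : exists k, k.+1%:R^-1 < e.
  have := archi_boundP (ltW (_ : 0 < e^-1)); rewrite invr_gt0 => /(_ e0) ek.
  exists (Num.bound e^-1); rewrite invf_plt ?posrE //.
  by apply: lt_le_trans ek _; rewrite ler_nat.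
have [j [y [i [jy ij iy]]]] := covered k.+1 z01.
have [t jt] := visits_all k.+1 j x01.
exists (iter (i + t) T x); split; first by exists (i + t)%N.
apply: HB; rewrite /ball /=.
have := level_shift jy jt (ltnW ij); rewrite iy -iterD => E.
have -> : z - iter (i + t) T x = y - iter t T x by lra.
apply: le_lt_trans ke; apply: le_trans (in_itv_dir_dist jy jt) _.
have -> : lft D k.+1 j + l k.+1 j - lft D k.+1 j = l k.+1 j by ring.
exact: le_trans (kl_le_tot _ _) (totS_le _).
Qed.

End keane_minimal.

(** * Birkhoff sums along the third towers *)

Section keane_birkhoff.
Context {R : realType} (D : keane R).
Implicit Types (i k n s t N q : nat) (j : letter) (w : seq letter) (x y z : R).
Implicit Types (f g : R -> R).

Notation T := (ket D).
Notation h := (kh D).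
Notation l := (kl D).

Definition pleft k j : R :=
  if ori k then base D k + lft D k j else base D k - (lft D k j + l k j).

Lemma pieceE k j x : piece D k j x = (pleft k j <= x < pleft k j + l k j).
Proof. by rewrite /piece /in_itv_dir /pleft; case: (ori k); apply/idP/idP; lra. Qed.

Lemma piece_pleft k j : piece D k j (pleft k j).
Proof. by rewrite pieceE lexx ltrDl kl_gt0. Qed.

Definition birkhoff g n x : R := \sum_(i < n) g (iter i T x).

Lemma birkhoffD g m n x :
  birkhoff g (m + n) x = birkhoff g m x + birkhoff g n (iter m T x).
Proof.
rewrite /birkhoff big_split_ord /=; congr (_ + _); apply: eq_bigr => i _.
by rewrite addnC iterD.
Qed.

Lemma birkhoff_le g M n x : (forall y, 0 <= y < 1 -> `|g y| <= M) -> 0 <= x < 1 ->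
  `|birkhoff g n x| <= M * n%:R.
Proof.
move=> gM x01; apply: le_trans (ler_norm_sum _ _ _) _.
apply: (@le_trans _ _ (\sum_(i < n) M)); last by rewrite sumr_const card_ord mulr_natr.
by apply: ler_sum => i _; apply/gM/iter_ket_itv.
Qed.

Definition others w : nat := sumn (map (fun j => if j is L3 then 0%N else 1%N) w).

Lemma others_cons j w : others (j :: w) = (others [:: j] + others w)%N.
Proof. by rewrite /others /= addn0. Qed.

Lemma wsum_cons k j w : wsum D k (j :: w) = (h k j + wsum D k w)%N.
Proof. by []. Qed.

Section window.
Variables (k hm : nat) (g : R -> R) (M om : R).
Hypothesis kh_le : forall j, (h k j <= hm)%N.
Hypothesis gM : forall y, 0 <= y < 1 -> `|g y| <= M.
Hypothesis om0 : 0 <= om.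
Hypothesis gL3 : forall y, piece D k L3 y -> `|birkhoff g (h k L3) y| <= om * (h k L3)%:R.

Let B := birkhoff g.

Let M0 : 0 <= M.
Proof. by apply: le_trans (gM (_ : 0 <= 0 < 1)); rewrite ?normr_ge0 // lexx ltr01. Qed.

Let Mhm : 0 <= M * hm%:R.
Proof. by rewrite mulr_ge0. Qed.

Let birkhoff_short n x : 0 <= x < 1 -> (n <= hm)%N -> `|B n x| <= M * hm%:R.
Proof.
move=> x01 nh; apply: le_trans (birkhoff_le _ gM x01) _.
by rewrite ler_wpM2l // ler_nat.
Qed.

Let birkhoff_piece j x : piece D k j x ->
  `|B (h k j) x| <= om * (h k j)%:R + M * hm%:R * (others [:: j])%:R.
Proof.
case: j => jx; rewrite /others /= ?addn0 ?mulr0 ?mulr1 ?addr0; last 1 first.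
  all: try (by exact: gL3).
all: rewrite (le_trans (birkhoff_short (piece_itv jx) (kh_le _))) // lerDr.
all: by rewrite mulr_ge0.
Qed.

(** The successor on [others w] pays for the passage interrupted at time [t]. *)
Lemma birkhoff_prefix w x y t : path D k w x y -> (t <= wsum D k w)%N ->
  `|B t x| <= om * t%:R + M * hm%:R * (others w).+1%:R.
Proof.
elim: w x t => [|j w IHw] x t.
  rewrite /wsum leqn0 => _ /eqP ->.
  by rewrite /B /birkhoff big_ord0 normr0 /others /= mulr0 add0r mulr1.
move=> [jx pw]; rewrite wsum_cons => tw.
have E := others_cons j w.
have [tj|jt] := leqP t (h k j).
  rewrite (le_trans (birkhoff_short (piece_itv jx) (leq_trans tj (kh_le _)))) //.
  rewrite -natr1 mulrDr mulr1 addrA lerDr addr_ge0 ?mulr_ge0 //.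
rewrite -(subnKC (ltnW jt)) [B _ _]birkhoffD -/B.
apply: le_trans (ler_normD _ _) _.
have := IHw _ (t - h k j)%N pw; rewrite leq_subLR => /(_ tw) Hw.
have Hj := birkhoff_piece jx.
by rewrite E -addnS (natrD _ (others _)) (natrD _ (h k j)); move: Hj Hw; lra.
Qed.

(* A third-interval excursion costs at most [om] per unit of time, the others are
   paid in full, as are the two excursions cut by the ends of the window. *)
Lemma birkhoff_window w x y s t : path D k w x y -> (s <= t <= wsum D k w)%N ->
  `|B (t - s) (iter s T x)| <= om * (t - s)%:R + M * hm%:R * (others w).+2%:R.
Proof.
elim: w x s t => [|j w IHw] x s t.
  rewrite /wsum => _ /andP[st]; rewrite leqn0 => /eqP t0; move: st; rewrite t0 leqn0 => /eqP ->.
  by rewrite /B /birkhoff big_ord0 normr0 /others /= mulr0 add0r mulr_ge0.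
move=> [jx pw]; rewrite wsum_cons => /andP[st tw].
have E := others_cons j w.
have [js|sj] := leqP (h k j) s.
  have /(IHw _ _ _ pw) : (s - h k j <= t - h k j <= wsum D k w)%N by lia.
  rewrite -iterD subnK // (_ : t - h k j - (s - h k j) = t - s)%N; last by lia.
  move=> /le_trans; apply; rewrite lerD2l ler_wpM2l // ler_nat E !ltnS leq_addl //.
have sx : 0 <= iter s T x < 1 by apply/iter_ket_itv/piece_itv/jx.
have [tj|jt] := leqP t (h k j).
  have /(birkhoff_short sx) Hs : (t - s <= hm)%N.
    by rewrite (leq_trans (leq_subr _ _)) // (leq_trans tj).
  apply: le_trans Hs _.
  by rewrite -natr1 mulrDr mulr1 addrA lerDr addr_ge0 ?mulr_ge0.
have -> : (t - s = (h k j - s) + (t - h k j))%N by lia.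
rewrite [B _ _]birkhoffD -/B -iterD subnK; last exact: ltnW.
apply: le_trans (ler_normD _ _) _.
have := birkhoff_prefix (t := t - h k j) pw; rewrite leq_subLR => /(_ tw) Hp.
have /(birkhoff_short sx) Hs : (h k j - s <= hm)%N.
  by rewrite (leq_trans (leq_subr _ _)).
have : 0 <= M * hm%:R * (others [:: j])%:R by rewrite mulr_ge0.
have : 0 <= om * (h k j - s)%:R by rewrite mulr_ge0.
by rewrite E -!addnS (natrD _ (others _)) (natrD _ (h k j - s)) -!natr1; move: Hp Hs; rewrite -!natr1; lra.
Qed.

End window.

Lemma path_flatten k w x y : path D k.+1 w x y ->
  path D k (flatten (map (word (kp D k) (kq D k)) w)) x y.
Proof.
elim: w x => [//|j w IHw] x [jx /IHw pw].
exact: path_cat (path_word jx) pw.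
Qed.

(** Only the initial [L4] and [L1] of each word of [L3] count. *)
Lemma others_flatten k n :
  others (flatten (map (word (kp D k) (kq D k)) (nseq n L3))) = (2 * n)%N.
Proof.
elim: n => [//|n]; rewrite /others /= map_cat sumn_cat /= => ->.
by rewrite map_nseq sumn_nseq mul0n; lia.
Qed.

Lemma wsum_flatten k w :
  wsum D k (flatten (map (word (kp D k) (kq D k)) w)) = wsum D k.+1 w.
Proof. by elim: w => //= j w; rewrite /wsum map_cat sumn_cat /= khS => ->. Qed.

(** The backward alternative serves to place [x] itself in the third tower, the forward one to keep
    its orbit there. *)
Definition shadow k x : Prop := exists t j,
  [/\ j <> L3, (t <= horizon (h k) k)%N &
    piece D k j (iter t T x) \/ exists2 y, piece D k j y & iter t T y = x].

Lemma letter_eq3 j : j = L3 \/ j <> L3.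
Proof. by case: j; [right|right|left|right]. Qed.

Lemma kh_le_horizon k j : (h k j <= horizon (h k) k)%N.
Proof. by rewrite /horizon /height_sum mulSn; case: j; lia. Qed.

(** [i] is the height of [x] in the third tower, and [n] counts the passages through it that begin
    by time [i + N]. The last inequality keeps [n] from being large compared with [N]. *)
Lemma shadow_path k N x : 0 <= x < 1 -> ~ shadow k x -> (N <= horizon (h k) k)%N ->
  exists i y n z, [/\ (i < h k L3)%N, iter i T y = x,
    path D k (nseq n L3) y z, (i + N < n * h k L3)%N & (n.-1 * h k L3 <= i + N)%N].
Proof.
move=> x01 nsx NH.
have [j [y [i [jy ij iy]]]] := covered D k x01.
have [j3|j3] := letter_eq3 j; last first.
  case: nsx; exists i, j; split => //; last by right; exists y.
  exact: leq_trans (ltnW ij) (kh_le_horizon _ _).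
rewrite {j}j3 in jy ij *.
have H r : (r * h k L3 <= i + N)%N -> piece D k L3 (iter (r * h k L3) T y).
  elim: r => [//|r IHr]; rewrite mulSn => rN.
  have {}IHr := IHr (leq_trans (leq_addl _ _) rN).
  have /section_piece[j jr] := section_return IHr; rewrite -iterD in jr.
  have [j3|j3] := letter_eq3 j; first by rewrite j3 in jr.
  case: nsx; exists (h k L3 + r * h k L3 - i)%N, j; split=> //.
    by rewrite leq_subLR (leq_trans rN) // leq_add2l.
  left; rewrite -iy -iterD subnK //; exact: leq_trans (ltnW ij) (leq_addr _ _).
have hP n x' : (forall r, (r < n)%N -> piece D k L3 (iter (r * h k L3) T x')) ->
   path D k (nseq n L3) x' (iter (n * h k L3) T x').
  elim: n x' => [//|n IHn] x' Hx' /=; split; first exact: (Hx' 0%N).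
  rewrite mulSn addnC iterD; apply: IHn => r rn.
  by rewrite -iterD -mulSnr; exact: Hx'.
exists i, y, ((i + N) %/ h k L3).+1, (iter (((i + N) %/ h k L3).+1 * h k L3) T y).
split => //.
- apply: hP => r rn; apply: H; rewrite -leq_divRL ?kh_gt0 //.
- by rewrite ltn_ceil // kh_gt0.
- by rewrite /= leq_trunc_div.
Qed.

Lemma kh_L3_large k : (horizon (h k) k <= h k.+1 L3)%N.
Proof.
apply: leq_trans (kq_large D k) _; rewrite khS /= map_nseq sumn_nseq.
by rewrite !addnA (leq_trans _ (leq_addl _ _)) // leq_pmull // kh_gt0.
Qed.

(** A passage through the third tower of level [k.+1] makes only two level-k passages elsewhere,
    each costing at most [M * height_sum (h k)]. Both [N] and the length of the passage are at least
    [k.+1] times this height sum. *)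
Lemma birkhoff_shadow k N x g M om :
  (forall y, 0 <= y < 1 -> `|g y| <= M) -> 0 <= om ->
  (forall y, piece D k L3 y -> `|birkhoff g (h k L3) y| <= om * (h k L3)%:R) ->
  0 <= x < 1 -> ~ shadow k.+1 x ->
  (horizon (h k) k <= N <= horizon (h k.+1) k.+1)%N ->
  `|birkhoff g N (T x)| <= N%:R * (om + 8 * M / k.+1%:R).
Proof.
move=> gM om0 gL3 x01 nsx /andP[HN NH].
have M0 : 0 <= M.
  by apply: le_trans (gM 0 _); rewrite ?normr_ge0 // lexx ltr01.
have [i [y [n [z [ih iy /path_flatten pn iN nN]]]]] := shadow_path x01 nsx NH.
have kh_le j : (h k j <= height_sum (h k))%N by rewrite /height_sum; case: j; lia.
(* The window starts at [i.+1], as the averages start at [T x]. *)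
have := birkhoff_window kh_le gM om0 gL3 (s := i.+1) (t := (i + N).+1) pn.
rewrite wsum_flatten /wsum map_nseq sumn_nseq mulnC iN ltnS leq_addr => /(_ isT).
rewrite iterS iy subSS addKn others_flatten => /le_trans; apply.
rewrite [X in _ <= X]mulrDr (mulrC N%:R om) lerD2l.
have h'0 : (0 < h k.+1 L3)%N := kh_gt0 D k.+1 L3.
have hm0 : (0 < height_sum (h k))%N by rewrite !addn_gt0 kh_gt0.
have Hh := kh_L3_large k.
(* With [H] the level-k horizon, [(n - 1) * H <= H + N]. Hence [(2 * n + 2) * H = 2 * (n - 1) * H +
   4 * H <= 6 * H + 2 * N <= 8 * N]. *)
have E1 : (k.+1 * height_sum (h k) * (2 * n).+2 <= 8 * N)%N.
  have n1 : (n.-1 * h k.+1 L3 <= h k.+1 L3 + N)%N.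
    by rewrite (leq_trans nN) // leq_add2r ltnW.
  have n2 : (n.-1 * horizon (h k) k <= horizon (h k) k + N)%N.
    have [nh|hn] := leqP n.-1 1; first by rewrite (leq_trans (leq_mul nh (leqnn _))) // mul1n leq_addr.
    have n3 : (n.-1.-1 * h k.+1 L3 <= N)%N.
      by rewrite -(leq_add2l (h k.+1 L3)) -mulSn prednK // (ltn_trans _ hn).
    rewrite -[n.-1 in X in (X <= _)%N]prednK ?(ltn_trans _ hn) // mulSn leq_add2l.
    by rewrite (leq_trans _ n3) // leq_mul2l Hh orbT.
  rewrite -[(k.+1 * _)%N]/(horizon (h k) k); move: n2 HN.
  set H := horizon _ _; case: n {nN iN pn n1} => [|n] /=; lia.
have -> : N%:R * (8 * M / k.+1%:R) = M * ((8 * N)%:R / k.+1%:R) :> R.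
  by rewrite natrM; ring.
rewrite -mulrA ler_wpM2l // ler_pdivlMr ?ltr0n // -!natrM ler_nat.
by rewrite mulnC mulnA; exact: E1.
Qed.

End keane_birkhoff.

(** * Invariant measures *)

Section measure_line.
Context {R : realType}.
Implicit Types mu : {measure set (measurableTypeR R) -> \bar R}.

(** Open left rays are stable under intersection, generate the Borel sets and exhaust the line. *)
Lemma measure_eq_rays mu1 mu2 :
  (forall x : R, mu1 `]-oo, x[%classic = mu2 `]-oo, x[%classic) ->
  (mu1 setT < +oo)%E ->
  forall A : set (measurableTypeR R), measurable A -> mu1 A = mu2 A.
Proof.
move=> E fin A mA.
have mG : (@RGenInftyO.G R : set (set (measurableTypeR R))) `<=` measurable.
  by move=> _ [x ->]; exact: measurable_itv.
apply: (@g_sigma_algebra_measure_unique _ R (measurableTypeR R) _ mG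
  (fun n => `]-oo, n%:R[%classic)).
- by move=> n; exists n%:R.
- rewrite -subTset => x _; exists (Num.bound (x : R)) => //=.
  have [x0|x0] := ltP (x : R) 0; rewrite in_itv /=.
    by rewrite (lt_le_trans x0).
  exact: archi_boundP.
- move=> _ _ [x ->] [y ->]; exists (Num.min x y); apply/seteqP; split=> z /=;
    rewrite !in_itv /= lt_min; [by case=> -> -> | by move/andP].
- by move=> _ [x ->].
- move=> n; apply: le_lt_trans fin; apply: le_measure => //; rewrite inE //.
- have Q := congr1 (fun P : set (set R) => P A) (RGenInftyO.measurableE R).
  exact: (eq_ind _ id mA _ Q).
Qed.

Lemma measure_itv_split mu (B : set (measurableTypeR R)) (a b c : R) : measurable B ->
  a <= b -> b <= c ->
  mu (B `&` `[a, c[) = (mu (B `&` `[a, b[) + mu (B `&` `[b, c[))%E.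
Proof.
move=> mB ab bc; rewrite -measureU.
- rewrite -setIUr; congr (mu (_ `&` _)); apply/seteqP; split=> z /=; rewrite !in_itv /=.
    by case: (ltP z b) => zb ?; [left|right]; lra.
  by case=> ?; lra.
- exact: measurableI.
- exact: measurableI.
- apply/seteqP; split=> z //= [[_]] /=; rewrite in_itv /= => /andP[_ zb] [_].
  by rewrite in_itv /= leNgt zb.
Qed.

End measure_line.

Section keane_invariance.
Context {R : realType} (D : keane R).
Implicit Types (mu : {measure set (measurableTypeR R) -> \bar R}) (j : letter).
Notation T := (ket D).
Notation l := (kl D).

Lemma ket_measurable : measurable_fun [set: measurableTypeR R] (T : _ -> measurableTypeR R).
Proof.
have ms j : measurable_fun [set: measurableTypeR R]
    (step D j : measurableTypeR R -> measurableTypeR R).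
  by apply: measurable_funD => //; exact: measurable_cst.
have mb j : measurable_fun [set: measurableTypeR R]
    (fun x : measurableTypeR R => (x : R) < lft D 0 j).
  by apply: measurable_fun_ltr => //; exact: measurable_cst.
by do 3! (apply: measurable_fun_ifT => //).
Qed.

Lemma iter_ket_measurable n :
  measurable_fun [set: measurableTypeR R] (iter n T : _ -> measurableTypeR R).
Proof.
elim: n => [|n IHn]; first exact: measurable_id.
exact: (measurableT_comp ket_measurable IHn).
Qed.

(** The form in which invariance is checked for both measures: it is translation invariance for
    Lebesgue measure, and an identity between increments of the distribution function for the
    other. *)
Definition exchange_preserving mu : Prop := forall j (u v : R),
  lft D 0 j <= u -> u <= v -> v <= lft D 0 j + l 0 j ->
  mu `[u + tau D 0 j, v + tau D 0 j[%classic = mu `[u, v[%classic.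

(** On one piece [T] is a translation, so both sides are finite measures of [A], and comparing them
    on rays is enough. *)
Lemma exchange_piece mu j (A : set (measurableTypeR R)) :
  (mu `[0%R, 1%R[%classic < +oo)%E -> exchange_preserving mu -> measurable A ->
  mu (T @^-1` A `&` `[lft D 0 j, lft D 0 j + l 0 j[) =
  mu (A `&` `[lft D 0 j + tau D 0 j, lft D 0 j + l 0 j + tau D 0 j[).
Proof.
move=> fin ex mA.
have mS (u v : R) : measurable (`[u, v[%classic : set (measurableTypeR R)).
  exact: measurable_itv.
have mshift : measurable_fun [set: measurableTypeR R]
    (step D j : measurableTypeR R -> measurableTypeR R).
  by apply: measurable_funD => //; exact: measurable_cst.
have l0 := kl_gt0 D 0 j.
have lft0 : 0 <= lft D 0 j.
  by have [] := kl_gt0s D 0; case: (j) => /=; lra.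
have lft1 : lft D 0 j + l 0 j <= 1.
  by have := kl0 D; have [] := kl_gt0s D 0; case: (j) => /=; lra.
have E1 : T @^-1` A `&` `[lft D 0 j, lft D 0 j + l 0 j[ =
    step D j @^-1` A `&` `[lft D 0 j, lft D 0 j + l 0 j[.
  apply/seteqP; split=> x [/= Ax xS]; split=> //; move: Ax;
    by rewrite (@ket_piece _ _ j) // /piece /in_itv_dir /= !add0r; move: xS; rewrite /= in_itv.
rewrite E1.
pose mI := mS (lft D 0 j + tau D 0 j) (lft D 0 j + l 0 j + tau D 0 j).
suff : pushforward (mrestr mu (mS (lft D 0 j) (lft D 0 j + l 0 j))) (step D j) A =
  mrestr mu mI A by [].
pose mu0 : {measure set (measurableTypeR R) -> \bar R} :=
  mrestr mu (mS (lft D 0 j) (lft D 0 j + l 0 j)).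
apply: (measure_eq_rays
  (mu1 := measure_function_pushforward__canonical__measure_function_Measure mu0 mshift)
  (mu2 := mrestr mu mI)) => // [x|]; last first.
  { apply: le_lt_trans fin; rewrite /pushforward /mrestr; apply: le_measure.
  - by rewrite inE; apply: measurableI => //; rewrite preimage_setT.
  - by rewrite inE.
  - by move=> z [_] /=; rewrite !in_itv /=; lra. }
suff : mu (step D j @^-1` `]-oo, x[ `&` `[lft D 0 j, lft D 0 j + l 0 j[) =
  mu (`]-oo, x[ `&` `[lft D 0 j + tau D 0 j, lft D 0 j + l 0 j + tau D 0 j[) by [].
(* [x - tau D 0 j] clamped to the piece: the ray, moved back, meets the piece in the interval from
   its left end to [v]. *)
pose v := Num.max (lft D 0 j) (Num.min (lft D 0 j + l 0 j) (x - tau D 0 j)).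
have vE : [\/ [/\ x - tau D 0 j < lft D 0 j & v = lft D 0 j],
    [/\ lft D 0 j <= x - tau D 0 j < lft D 0 j + l 0 j & v = x - tau D 0 j] |
    [/\ lft D 0 j + l 0 j <= x - tau D 0 j & v = lft D 0 j + l 0 j]].
  rewrite /v; have [xa|xa] := ltP (x - tau D 0 j) (lft D 0 j).
    constructor 1; split=> //; apply/max_idPl; rewrite ge_min; apply/orP; right; exact: ltW.
  have [xb|xb] := ltP (x - tau D 0 j) (lft D 0 j + l 0 j).
    by constructor 2; split=> //; apply/max_idPr.
  by constructor 3; split=> //; apply/max_idPr; lra.
have -> : step D j @^-1` `]-oo, x[ `&` `[lft D 0 j, lft D 0 j + l 0 j[ =
    `[lft D 0 j, v[%classic.
  apply/seteqP; split=> z; rewrite /step /= !in_itv /=.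
    by case=> ? ?; case: vE => -[? ->]; lra.
  by case: vE => -[? ->] ?; split; lra.
have -> : `]-oo, x[ `&` `[lft D 0 j + tau D 0 j, lft D 0 j + l 0 j + tau D 0 j[ =
    `[lft D 0 j + tau D 0 j, v + tau D 0 j[%classic.
  apply/seteqP; split=> z /=; rewrite !in_itv /=.
    by case=> ? ?; case: vE => -[? ->]; lra.
  by case: vE => -[? ->] ?; split; lra.
by apply/esym/ex => //; case: vE => -[? ->]; lra.
Qed.

(** The unit interval is cut into the four pieces for the preimage, and into their images, in the
    order I_4, I_2, I_1, I_3, for [A]. *)
Lemma ket_invariant mu : (mu `[0%R, 1%R[%classic < +oo)%E ->
  exchange_preserving mu -> invariant_measure T mu.
Proof.
move=> fin ex A mA A01.
have [g1 g2 g3 g4] := kl_gt0s D 0.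
have l1 := kl0 D.
have mT : measurable (T @^-1` A).
  by rewrite -[X in measurable X]setTI; exact: ket_measurable.
have E j := exchange_piece j fin ex mA.
have sA : A = A `&` `[0, 1[ by rewrite setIidl.
rewrite [in RHS]sA setIC.
rewrite (@measure_itv_split _ mu _ 0 (lft D 0 L2)) //=; [|lra|lra].
rewrite (@measure_itv_split _ mu _ (lft D 0 L2) (lft D 0 L3)) //=; [|lra|lra].
rewrite (@measure_itv_split _ mu _ (lft D 0 L3) (lft D 0 L4)) //=; [|lra|lra].
rewrite (@measure_itv_split _ mu A 0 (l 0 L4)) //=; [|lra|lra].
rewrite (@measure_itv_split _ mu A (l 0 L4) (l 0 L4 + l 0 L2)) //=; [|lra|lra].
rewrite (@measure_itv_split _ mu A (l 0 L4 + l 0 L2) (l 0 L4 + l 0 L2 + l 0 L1)) //=; [|lra|lra].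
have := (E L1, E L2, E L3, E L4) => /=.
rewrite (_ : 0 + l 0 L1 = l 0 L1); last by ring.
rewrite (_ : 0 + (l 0 L4 + l 0 L2) = l 0 L4 + l 0 L2); last by ring.
rewrite (_ : l 0 L1 + (l 0 L4 + l 0 L2) = l 0 L4 + l 0 L2 + l 0 L1); last by ring.
rewrite (_ : l 0 L1 + (l 0 L4 - l 0 L1) = l 0 L4); last by ring.
rewrite (_ : l 0 L1 + l 0 L2 + (l 0 L4 - l 0 L1) = l 0 L4 + l 0 L2); last by ring.
rewrite (_ : l 0 L1 + l 0 L2 + l 0 L4 = l 0 L4 + l 0 L2 + l 0 L1); last by ring.
rewrite (_ : l 0 L1 + l 0 L2 + l 0 L3 + l 0 L4 = 1); last by [].
rewrite (_ : l 0 L1 + l 0 L2 + l 0 L3 - (l 0 L1 + l 0 L2 + l 0 L3) = 0); last by ring.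
rewrite (_ : 1 - (l 0 L1 + l 0 L2 + l 0 L3) = l 0 L4); last by rewrite -l1; ring.
move=> -[[[-> ->] ->] ->].
by rewrite [RHS]addeC -!addeA addeCA.
Qed.

Lemma lebesgue_exchange : exchange_preserving (@lebesgue_measure R).
Proof.
move=> j u v _ uv _; apply: etrans (lebesgue_measure_itv _) (esym _).
apply: etrans (lebesgue_measure_itv _) _; rewrite /= !lte_fin ltrD2r.
by case: ifP => // _; rewrite -!EFinD; congr (_%:E); ring.
Qed.

Lemma lebesgue_invariant : invariant_measure T (@lebesgue_measure R).
Proof.
apply: ket_invariant lebesgue_exchange.
rewrite (_ : _ `[0, 1[%classic = lebesgue_measure (`[0, 1[%classic : set R)) //.
by rewrite lebesgue_measure_itv /= lte_fin ltr01 -EFinD ltry.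
Qed.

End keane_invariance.

(** * Hausdorff dimension and covers *)

Section covering.
Context {R : realType}.
Implicit Types (s : seq R) (r x : R).

Definition intervals s r : set R := \big[setU/set0]_(u <- s) `[u, u + r]%classic.

Lemma intervalsP s r x : reflect (exists2 u, u \in s & u <= x <= u + r)
  (x \in intervals s r).
Proof.
apply: (iffP idP); rewrite /intervals inE.
  elim: s => [|u s IHs]; rewrite ?big_nil // big_cons => -[|/IHs[v vs Hv]].
    by rewrite /= in_itv /= => Hx; exists u; rewrite ?mem_head.
  by exists v; rewrite // in_cons vs orbT.
case=> u; elim: s => [//|v s IHs]; rewrite in_cons big_cons => /orP[/eqP ->|us] Hx.
  by left; rewrite /= in_itv.
by right; exact: IHs.
Qed.

Lemma measurable_intervals s r : measurable (intervals s r : set (measurableTypeR R)).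
Proof. by apply: bigsetU_measurable => u _; exact: measurable_itv. Qed.

Lemma lebesgue_intervals s r : 0 <= r ->
  (lebesgue_measure (intervals s r : set (measurableTypeR R)) <= ((size s)%:R * r)%:E)%E.
Proof.
move=> r0; elim: s => [|u s IHs]; rewrite /intervals.
  by rewrite big_nil measure0 mul0r.
rewrite big_cons -/(intervals s r).
have mu : measurable (`[u, u + r]%classic : set (measurableTypeR R)) by exact: measurable_itv.
apply: le_trans (measureU2 (@lebesgue_measure R) mu (measurable_intervals s r)) _.
rewrite /= -nat1r mulrDl mul1r EFinD leeD //.
apply: (@le_trans _ _ (lebesgue_measure (`[u, u + r]%classic : set R))) => //.
rewrite lebesgue_measure_itv /= lte_fin; case: ifP => _; last by rewrite lee_fin.
by rewrite -EFinD lee_fin; lra.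
Qed.

Lemma nneseries_le (f : nat -> \bar R) (c : \bar R) : (forall n, 0 <= f n)%E ->
  (forall n, \sum_(0 <= i < n) f i <= c)%E -> (\sum_(0 <= i <oo) f i <= c)%E.
Proof.
move=> f0 fc; apply: lime_le; first by apply: is_cvg_nneseries => n _ _; exact: f0.
exact: nearW.
Qed.

(** Once [s * k.+1 >= 1], an interval of level [k] contributes at most [(Q k)%:R^-1], the whole
    level at most [2 ^- k], and all levels from [K] on at most [2 * 2 ^- K]. Thus the measure
    vanishes for every [s > 0]. *)
Lemma hausdorff_dim_eq0 (A : set R) (G : nat -> seq R) (Q : nat -> nat) :
  (forall k, (4 <= Q k)%N) -> (forall k, (2 ^ k * size (G k) <= Q k)%N) ->
  (forall K, A `<=` \bigcup_(k in [set k | (K <= k)%N]) intervals (G k) ((Q k)%:R ^- k.+1)) ->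
  hausdorff_dim A = 0%E.
Proof.
move=> Q4 QG AG.
pose r k : R := (Q k)%:R ^- k.+1.
have Q0 k : 0 < (Q k)%:R :> R by rewrite ltr0n (leq_trans _ (Q4 k)).
have r0 k : 0 < r k by rewrite invr_gt0 exprn_gt0.
have rk k : r k <= k.+1%:R^-1.
  rewrite /r -natrX lef_pV2 ?posrE ?ltr0n ?expn_gt0 ?(leq_trans _ (Q4 k)) //.
  rewrite ler_nat (leq_trans (ltnW (ltn_expl k.+1 (isT : 1 < 4)%N))) //.
  by rewrite leq_exp2r.
have diam_ge0 (U : set R) : U !=set0 -> (0 <= diameter U)%E.
  move=> [x Ux]; apply: ereal_sup_ubound; exists (x, x) => //=.
  by rewrite subrr normr0.
have pow_ge0 (t : R) (U : set R) : (0 <= diameter_pow t U)%E.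
  by rewrite /diameter_pow; case: pselect => [?|?] //=; exact: poweR_ge0.
have pre_ge0 (t d : R) (B : set R) : (0 <= hausdorff_premeasure t d B)%E.
  by apply: le_ereal_inf_tmp => x [U HU <-]; exact: nneseries_ge0.
have haus (s : R) : 0 < s -> hausdorff_measure s A = 0%E.
  move=> s0; apply/eqP; rewrite eq_le; apply/andP; split; last first.
    apply: le_trans (pre_ge0 s 1 A) _; apply: ereal_sup_ubound.
    by exists 1 => //=.
  apply: ge_ereal_sup => _ [d /= d0 <-].
  apply/lee_addgt0Pr => e e0; rewrite add0e.
  have [K [Ks Kd Ke]] : exists K, [/\ 1 <= s * K.+1%:R, K.+1%:R^-1 <= d &
      2 * 2 ^- K <= e :> R].
  (* A single integer above the sum of the three bounds meets the three requirements. *)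
  { have sde0 : 0 <= s^-1 + d^-1 + 2 / e.
      by rewrite !addr_ge0 ?invr_ge0 ?divr_ge0 // ltW.
    have := archi_boundP sde0; set K := Num.bound _ => HK; exists K.
    have s0' : 0 <= s^-1 by rewrite invr_ge0 ltW.
    have d0' : 0 <= d^-1 by rewrite invr_ge0 ltW.
    have e0' : 0 <= 2 / e by rewrite divr_ge0 // ltW.
    split.
    - rewrite mulrC -ler_pdivrMr // div1r -natr1; lra.
    - by rewrite invf_ple ?posrE // -natr1; lra.
    - rewrite ler_pdivrMr ?exprn_gt0 // mulrC -ler_pdivrMr //.
      have : K%:R <= 2 ^+ K :> R by rewrite -natrX ler_nat ltnW // ltn_expl.
      lra. }
  have [phi phiP] : exists phi : nat -> nat * nat, set_bij setT setT phi.
    exact/card_set_bijP/card_esym/card_nat2.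
  (* A pair gives a level, counted from [K], and a place in its list. Past the end of the list the
     set is empty and contributes 0. *)
  pose V (p : nat * nat) : set R :=
    if (p.2 < size (G (K + p.1)%N))%N then
      `[nth 0 (G (K + p.1)%N) p.2, nth 0 (G (K + p.1)%N) p.2 + r (K + p.1)%N]%classic
    else set0.
  have Vdiam p : (diameter (V p) <= (r (K + p.1)%N)%:E)%E.
    apply: ge_ereal_sup => _ [[x y] [/= Vx Vy] <-]; move: Vx Vy; rewrite /V.
    case: ifP => // _; rewrite /= !in_itv /= => ? ?.
    by rewrite lee_fin ler_norml; lra.
  have Vpow p : (diameter_pow s (V p) <=
      if (p.2 < size (G (K + p.1)%N))%N then ((Q (K + p.1)%N)%:R^-1)%:E else 0)%E.
    rewrite /diameter_pow; case: pselect => [?|V0] /=.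
      by case: ifP => // _; rewrite lee_fin invr_ge0 ltW.
    have [_|pG] := ltnP p.2 (size (G (K + p.1)%N)); last first.
      by case: V0; rewrite /V ltnNge pG.
    have /set0P Vn : V p != set0 by apply/eqP.
    apply: (@le_trans _ _ (poweR (r (K + p.1)%N)%:E s)).
      apply: gt0_ler_poweR; rewrite ?(ltW s0) //.
        by rewrite in_itv /= diam_ge0 // leey.
      by rewrite in_itv /= lee_fin ltW // leey.
    rewrite poweR_EFin lee_fin /r -exprVn -powR_mulrn ?invr_ge0 ?(ltW (Q0 _)) //.
    rewrite -powRrM; apply: ge1r_powR.
      by rewrite invr_gt0 Q0 invf_le1 ?Q0 // ler1n (leq_trans _ (Q4 _)).
    apply: le_trans Ks _; rewrite mulrC ler_wpM2r ?(ltW s0) //.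
    by rewrite ler_nat ltnS leq_addr.
  apply: (@le_trans _ _ (\sum_(0 <= i <oo) diameter_pow s (V (phi i)))%E).
    apply: ereal_inf_lbound; exists (V \o phi) => //; split=> [x /(AG K)[k /= Kk xk]|i] /=.
      have /intervalsP[u uG xu] : x \in intervals (G k) (r k) by rewrite inE.
      have [_ _ /(_ ((k - K)%N, index u (G k)) Logic.I)[n _ nE]] := phiP.
      exists n => //=; rewrite /V nE /= subnKC // index_mem uG nth_index //.
    apply: le_trans (Vdiam _) _; rewrite lee_fin.
    apply: le_trans (rk _) _; apply: le_trans Kd.
    by rewrite lef_pV2 ?posrE ?ltr0n // ler_nat ltnS leq_addr.
  rewrite nneseries_esumT //.
  rewrite -(@reindex_esum R _ _ setT setT phi (fun p => diameter_pow s (V p))) //.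
  rewrite (_ : setT = setT `*`` (fun=> setT)); last by apply/seteqP.
  rewrite -(@esum_esum R _ _ setT (fun=> setT) (fun i j => diameter_pow s (V (i, j)))) //=.
  apply: (@le_trans _ _ (\esum_(k in [set: nat]) (2 ^- (K + k))%:E)).
    apply: le_esum => k _; rewrite -nneseries_esumT //; apply: nneseries_le => // n.
    apply: (@le_trans _ _ (((minn n (size (G (K + k)%N)))%:R / (Q (K + k)%N)%:R)%:E)).
      elim: n => [|n IHn]; first by rewrite big_nil min0n mul0r.
      rewrite big_nat_recr //=.
      have := Vpow (k, n); rewrite /=; case: ltnP => nG Hn.
        apply: le_trans (leeD IHn Hn) _.
        rewrite -EFinD lee_fin (minn_idPl (ltnW nG)) (minn_idPl nG) -natr1; lra.
      apply: le_trans (leeD IHn Hn) _.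
      by rewrite adde0 (minn_idPr nG) (minn_idPr (leqW nG)).
    rewrite lee_fin ler_pdivrMr // mulrC ler_pdivlMr ?exprn_gt0 // -natrX -natrM ler_nat.
    rewrite mulnC; apply: leq_trans (QG _).
    by rewrite leq_mul2l geq_minr orbT.
  rewrite -nneseries_esumT; last by move=> k; rewrite lee_fin invr_ge0 exprn_ge0.
  apply: le_trans (_ : ((2 * 2 ^- K)%:E <= e%:E)%E); last by rewrite lee_fin.
  apply: nneseries_le => [k|n]; first by rewrite lee_fin invr_ge0 exprn_ge0.
  (* The exact value of the geometric partial sum, which makes the induction close. *)
  apply: (@le_trans _ _ (2 * 2 ^- K - 2 * 2 ^- (K + n))%:E); last first.
    by rewrite lee_fin gerBl mulr_ge0 // invr_ge0 exprn_ge0.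
  elim: n => [|n IHn]; first by rewrite big_nil addn0 subrr.
  rewrite big_nat_recr //=; apply: le_trans (leeD IHn (le_refl _)) _.
  rewrite -EFinD lee_fin addnS exprS invfM.
  set z := (2 ^+ (K + n))^-1; lra.
apply/eqP; rewrite eq_le; apply/andP; split; last first.
  by apply: le_ereal_inf_tmp => x [t [t0 Ht] <-]; rewrite lee_fin.
apply/lee_addgt0Pr => e e0; rewrite add0e; apply: ereal_inf_lbound.
by exists e => //=; split; [exact: ltW|exact: haus].
Qed.

End covering.

(** * Covers of the shadows by short intervals *)

Section shadow_cover.
Context {R : realType} (D : keane R).
Implicit Types (i k t : nat) (j : letter) (x : R).
Notation T := (ket D).
Notation h := (kh D).

Definition taus : seq R := [:: tau D 0 L1; tau D 0 L2; tau D 0 L3; tau D 0 L4].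

Definition shifts i : seq R := iter i (fun s => [seq v + u | v <- taus, u <- s]) [:: 0].

Lemma size_shifts i : size (shifts i) = (4 ^ i)%N.
Proof. by elim: i => // i IHi; rewrite [shifts _]iterS size_allpairs IHi expnS. Qed.

Lemma iter_shifts i x : exists2 s, s \in shifts i & iter i T x = x + s.
Proof.
elim: i => [|i [s ss E]]; first by exists 0; rewrite ?inE // addr0.
have [v vt Ev] : exists2 v, v \in taus & T (x + s) = x + s + v.
  rewrite /ket /step /taus.
  case: ifP => _; first by exists (tau D 0 L1); rewrite ?inE ?eqxx.
  case: ifP => _; first by exists (tau D 0 L2); rewrite ?inE ?eqxx ?orbT.
  case: ifP => _; first by exists (tau D 0 L3); rewrite ?inE ?eqxx ?orbT.
  by exists (tau D 0 L4); rewrite ?inE ?eqxx ?orbT.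
exists (v + s); first exact: allpairs_f.
by rewrite iterS E Ev -addrA (addrC s).
Qed.

Definition bad_lefts k : seq R := [:: pleft D k L1; pleft D k L2; pleft D k L4].

(** If the orbit of [x] is displaced by [s] into the piece starting at [u], then [x] lies just after
    [u - s]; if [x] comes from that piece, it lies just after [u + s]. *)
Definition shadow_lefts k : seq R :=
  flatten [seq [seq u - s | u <- bad_lefts k, s <- shifts i] ++
               [seq u + s | u <- bad_lefts k, s <- shifts i]
          | i <- iota 0 (horizon (h k) k).+1].

Lemma size_shadow_lefts k : (size (shadow_lefts k) <= cover_size (horizon (h k) k))%N.
Proof.
rewrite /shadow_lefts /cover_size; set H := horizon _ _.
rewrite size_flatten /shape -map_comp sumnE big_map.
have -> : (6 * H.+1 * 4 ^ H = \sum_(i <- iota 0 H.+1) 6 * 4 ^ H)%N.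
  by rewrite big_const_seq count_predT size_iota iter_addn_0 mulnAC.
rewrite big_seq [leqRHS]big_seq; apply: leq_sum => i; rewrite mem_iota /= add0n ltnS => iH.
rewrite /comp !size_cat !size_map /= size_shifts.
by have := leq_pexp2l (isT : 0 < 4)%N iH; lia.
Qed.

Lemma shadow_intervals k x : shadow D k x -> x \in intervals (shadow_lefts k) (rho D k).
Proof.
have lk j : j <> L3 -> pleft D k j \in bad_lefts k.
  by case: j => // _; rewrite !inE eqxx ?orbT.
move=> [t [j [j3 tH Hx]]]; apply/intervalsP.
have tI : t \in iota 0 (horizon (h k) k).+1 by rewrite mem_iota.
have lr : kl D k j <= rho D k by exact: kl_small.
case: Hx => [|[y +]].
  have [s ss ->] := iter_shifts t x; rewrite pieceE => Hx.
  exists (pleft D k j - s); last by lra.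
  apply/flatten_mapP; exists t => //; rewrite mem_cat; apply/orP; left.
  by apply: allpairs_f => //; exact: lk.
have [s ss ->] := iter_shifts t y; rewrite pieceE => Hy Ex.
exists (pleft D k j + s); last by rewrite -Ex; lra.
apply/flatten_mapP; exists t => //; rewrite mem_cat; apply/orP; right.
by apply: allpairs_f => //; exact: lk.
Qed.

(** With [Q = kQ D k], there are at most [Q / 2 ^ k] intervals of length [Q ^- k.+1], and
    [Q * Q ^- k.+1 <= 1]. *)
Lemma lebesgue_shadow_cover k :
  (lebesgue_measure (intervals (shadow_lefts k) (rho D k) : set (measurableTypeR R))
    <= (2 ^- k)%:E)%E.
Proof.
apply: le_trans (lebesgue_intervals _ (ltW (rho_gt0 _ _))) _.
have Q0 : (0 < kQ D k)%N by rewrite (leq_trans _ (kQ_ge4 D k)).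
rewrite lee_fin /rho ler_pdivrMr ?exprn_gt0 ?ltr0n // mulrC ler_pdivlMr ?exprn_gt0 //.
rewrite -!natrX -natrM ler_nat mulnC.
apply: leq_trans (leq_mul (leqnn _) (size_shadow_lefts k)) _.
apply: leq_trans (kQ_cover D k) _.
by rewrite expnS leq_pmulr // expn_gt0 Q0.
Qed.

End shadow_cover.

(** * Generic points and ergodicity *)

Section keane_integral.
Context {R : realType} (D : keane R).
Implicit Types (i k n N : nat) (j : letter) (x y : R) (f g : R -> R).
Implicit Types A : set (measurableTypeR R).
Notation T := (ket D).
Notation h := (kh D).
Notation mu := (@lebesgue_measure R).

Definition invariant_set A : Prop :=
  [/\ measurable A, A `<=` `[0, 1[ & `[0, 1[ `&` T @^-1` A = A].

Definition bounded_measurable g (M : R) : Prop :=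
  measurable_fun [set: measurableTypeR R] g /\ forall x, `|g x| <= M.

Lemma invariant_set_itv : invariant_set `[0, 1[%classic.
Proof.
split; [exact: measurable_itv | by [] | ].
apply/seteqP; split=> [x []//|x x01]; split=> //=; move: x01; rewrite /= !in_itv /=.
exact: ket_itv.
Qed.

Lemma lebesgue_unit : mu `[0, 1[%classic = 1%E.
Proof.
apply: etrans (lebesgue_measure_itv `[0, 1[%R) _.
by rewrite /= lte_fin ltr01 oppr0 adde0.
Qed.

Lemma lebesgue_finite A : A `<=` `[0, 1[ -> measurable A -> (mu A <= 1)%E.
Proof.
move=> A01 mA; rewrite -lebesgue_unit; apply: le_measure => //; rewrite inE //.
Qed.

Lemma bounded_integrable A g M : A `<=` `[0, 1[ -> measurable A ->
  bounded_measurable g M -> mu.-integrable A (EFin \o g).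
Proof.
move=> A01 mA [mg gM]; apply: measurable_bounded_integrable => //.
- by apply: le_lt_trans (lebesgue_finite A01 mA) _; rewrite ltry.
- exact: measurable_funTS.
- by exists M; split; rewrite ?num_real // => z Mz x _ /=; rewrite (le_trans (gM _)) // ltW.
Qed.

Lemma bounded_measurable_iter g M n : bounded_measurable g M ->
  bounded_measurable (g \o iter n T) M.
Proof.
move=> [mg gM]; split => [|x]; last exact: gM.
exact: measurableT_comp mg (iter_ket_measurable D n).
Qed.

Lemma integral_ket A g M : invariant_set A -> bounded_measurable g M ->
  \int[mu]_(x in A) g (T x) = \int[mu]_(x in A) g x.
Proof.
move=> [mA A01 AT] [mg gM]; congr fine.
(* The invariance hypothesis only concerns [0, 1): outside, replace [T] by the identity. *)
pose T' (x : measurableTypeR R) : measurableTypeR R :=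
  if (x : R) < 0 then x else if (x : R) < 1 then T x else x.
have T'in x : 0 <= x < 1 -> T' x = T x by case/andP=> x0 x1; rewrite /T' ltNge x0 x1.
have T'out x : ~~ (0 <= x < 1) -> T' x = x.
  by rewrite /T'; case: (ltP x 0) => // x0; rewrite andTb => /negbTE ->.
have mT' : measurable_fun [set: measurableTypeR R] T'.
  apply: measurable_fun_ifT; [|exact: measurable_id|].
    by apply: measurable_fun_ltr => //; exact: measurable_cst.
  apply: measurable_fun_ifT; [|exact: ket_measurable|exact: measurable_id].
  by apply: measurable_fun_ltr => //; exact: measurable_cst.
have T'E B : B `<=` `[0, 1[ -> T' @^-1` B = `[0, 1[ `&` T @^-1` B.
  { move=> B01; apply/seteqP; split=> x /=; rewrite in_itv /=.
  - have [x01|x01] := boolP (0 <= x < 1); first by rewrite T'in.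
    by rewrite T'out // => /B01; rewrite /= in_itv /= (negbTE x01).
  - by move=> [x01]; rewrite T'in. }
have T'A : T' @^-1` A = A by rewrite T'E.
transitivity (\int[mu]_(x in T' @^-1` A) (EFin \o g \o T') x)%E.
  rewrite T'A; apply: eq_integral => x; rewrite inE => /A01.
  by rewrite /= in_itv /= => ?; rewrite T'in.
rewrite -(integral_pushforward mT').
- apply: eq_measure_integral => B mB BA; have B01 := subset_trans BA A01.
  transitivity (mu (`[0, 1[ `&` T @^-1` B)); last exact: lebesgue_invariant.
  by rewrite -T'E.
- exact/measurable_EFinP.
- rewrite T'A -compA; apply: (@bounded_integrable A (g \o T') M) => //; split=> [|x]; last exact: gM.
  exact: measurableT_comp.
- exact: mA.
Qed.

Lemma integral_iter_ket A g M n : invariant_set A -> bounded_measurable g M ->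
  \int[mu]_(x in A) g (iter n T x) = \int[mu]_(x in A) g x.
Proof.
move=> iA bg; elim: n => [//|n IHn]; rewrite -IHn -(integral_ket iA (bounded_measurable_iter n bg)).
by apply: eq_Rintegral => x _; rewrite /= -iterSr.
Qed.

Lemma bounded_measurable_birkhoff g M n : bounded_measurable g M ->
  bounded_measurable (fun x => birkhoff D g n (T x)) (n%:R * M).
Proof.
move=> bg; split=> [|x].
  rewrite /birkhoff; apply: measurable_sum => i.
  have [+ _] := bounded_measurable_iter i.+1 bg.
  by apply: eq_measurable_fun => y _; rewrite /= -iterSr.
apply: le_trans (ler_norm_sum _ _ _) _.
apply: (@le_trans _ _ (\sum_(i < n) M)); first by apply: ler_sum => i _; case: bg.
by rewrite sumr_const card_ord mulr_natl.
Qed.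

Lemma integral_birkhoff A g M n : invariant_set A -> bounded_measurable g M ->
  \int[mu]_(x in A) birkhoff D g n (T x) = n%:R * \int[mu]_(x in A) g x.
Proof.
move=> iA bg; have [mA A01 _] := iA.
elim: n => [|n IHn].
  rewrite mul0r -[RHS](@Rintegral_set0 _ _ _ mu (fun=> 0)) /birkhoff.
  under eq_Rintegral do rewrite big_ord0.
  by rewrite Rintegral_cst // mul0r Rintegral_set0.
under eq_Rintegral do rewrite /birkhoff big_ord_recr /= -iterSr -[X in X + _]/(birkhoff D g n (T _)).
rewrite RintegralD //.
- by rewrite IHn (integral_iter_ket n.+1 iA bg) -natr1 mulrDl mul1r.
- exact: (bounded_integrable A01 mA (bounded_measurable_birkhoff n bg)).
- exact: (bounded_integrable A01 mA (bounded_measurable_iter n.+1 bg)).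
Qed.

End keane_integral.

(** * Continuous functions on the closed unit interval *)

Section uniform_continuity.
Context {R : realType}.
Implicit Types f g : R -> R.

Definition uniform_on_unit g : Prop := forall e : R, 0 < e -> exists2 d : R, 0 < d &
  forall x y, 0 <= x < 1 -> 0 <= y < 1 -> `|x - y| <= d -> `|g x - g y| <= e.

(** Heine's theorem, from compactness in its near-covering form with the distance bound tending to 0
    from the right as parameter. *)
Lemma within_continuous_uniform f : {within `[0, 1], continuous f} ->
  uniform_on_unit f.
Proof.
move=> /subspace_continuousP cf e e0.
have cK : compact (`[0, 1]%classic : set R) by exact: segment_compact.
have /compact_near_coveringP HK := cK.
have := HK R (at_right (0 : R)) (fun d x => 0 <= x <= 1 -> forall y, 0 <= y <= 1 -> `|x - y| <= d ->
  `|f x - f y| <= e) (at_right_proper_filter _).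
case=> [x0 x01|d /= d0 Hd].
  have /cvgrPdist_le /(_ (e / 2)) := cf x0 x01; rewrite divr_gt0 // => /(_ isT).
  rewrite near_withinE => /nbhs_ballP[d /= d0 Hd].
  exists (ball x0 (d / 2), [set r | r < d / 2]).
    split; first by apply: nbhsx_ballx; rewrite divr_gt0.
    by apply: nbhs_right_lt; rewrite divr_gt0.
  move=> [x r] [/= xd rd] x1 y y1 xy.
  have Hx : `|f x0 - f x| <= e / 2.
    by apply: Hd => /=; [apply: le_ball xd; lra|rewrite in_itv].
  have Hy : `|f x0 - f y| <= e / 2.
    apply: Hd => /=; last by rewrite in_itv.
    move: xd; rewrite /ball /= => xd.
    have := ler_normD (x0 - x) (x - y); rewrite addrA subrK; lra.
  have := ler_normB (f x0 - f y) (f x0 - f x).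
  rewrite (_ : f x0 - f y - (f x0 - f x) = f x - f y); last by ring.
  lra.
exists (d / 2); first by rewrite divr_gt0.
have dd : ball (0 : R) d (d / 2) by rewrite /ball /= sub0r normrN gtr0_norm ?divr_gt0 //; lra.
move=> x y x01 y01 xy; apply: (Hd (d / 2) dd) _ _ xy => //=; rewrite ?divr_gt0 ?in_itv /=; lra.
Qed.

(** Extension by zero gives a function bounded and measurable on the whole line with the same values
    along orbits. *)
Lemma within_continuous_bounded f : {within `[0, 1], continuous f} ->
  exists M, bounded_measurable (f \_ `[0, 1]) M.
Proof.
move=> cf.
have [M [_ HM]] := compact_bounded (continuous_compact cf (@segment_compact R 0 1)).
exists (`|M| + 1); split.
  apply/(measurable_restrictT _ _).1; first exact: measurable_itv.
  by apply: subspace_continuous_measurable_fun => //; exact: measurable_itv.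
move=> x; rewrite patchE; case: ifPn => [|_]; last by rewrite normr0 addr_ge0.
rewrite inE => x01; apply: (HM (`|M| + 1)); last by exists x.
by rewrite (le_lt_trans (ler_norm _)) // ltrDl.
Qed.

End uniform_continuity.

Section keane_generic.
Context {R : realType} (D : keane R).
Implicit Types (i k n N : nat) (j : letter) (x y : R) (f g : R -> R).
Implicit Types A : set (measurableTypeR R).
Notation T := (ket D).
Notation h := (kh D).
Notation mu := (@lebesgue_measure R).

Definition tower_mean g k : R := birkhoff D g (h k L3) (pleft D k L3) / (h k L3)%:R.

Lemma tower_mean_le g M k : (forall y, 0 <= y < 1 -> `|g y| <= M) ->
  `|tower_mean g k| <= M.
Proof.
move=> gM; have h0 : 0 < (h k L3)%:R :> R by rewrite ltr0n kh_gt0.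
rewrite normrM normfV (gtr0_norm h0) ler_pdivrMr //.
exact: birkhoff_le gM (piece_itv (piece_pleft D k L3)).
Qed.

Lemma birkhoffB g c n x : birkhoff D (fun y => g y - c) n x = birkhoff D g n x - n%:R * c.
Proof. by rewrite /birkhoff sumrB sumr_const card_ord mulr_natl. Qed.

Lemma horizon_gt0 k : (0 < horizon (h k) k)%N.
Proof. by rewrite muln_gt0 /= !addn_gt0 kh_gt0. Qed.

Lemma horizon_gt k : (k < horizon (h k) k)%N.
Proof. by rewrite /horizon leq_pmulr // !addn_gt0 kh_gt0. Qed.

Lemma horizon_le k : (horizon (h k) k <= horizon (h k.+1) k.+1)%N.
Proof. exact: leq_trans (kh_L3_large D k) (kh_le_horizon D k.+1 L3). Qed.

(** The third piece is short, so by uniform continuity the mean of [g] over a passage through its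
    tower is within [e / 2] of [tower_mean], wherever it starts. Then [birkhoff_shadow] applies to
    [g] minus this constant, which is bounded by [2 * M]. *)
Lemma birkhoff_approx g M : (forall y, 0 <= y < 1 -> `|g y| <= M) ->
  uniform_on_unit g -> forall e, 0 < e -> exists K, forall k, (K <= k)%N ->
  forall x, 0 <= x < 1 -> ~ shadow D k.+1 x ->
  forall N, (horizon (h k) k <= N <= horizon (h k.+1) k.+1)%N ->
  `|N%:R^-1 * birkhoff D g N (T x) - tower_mean g k| <= e.
Proof.
move=> gM ug e e0; have [d d0 gd] := ug (e / 2) (divr_gt0 e0 (ltr0Sn _ 1)).
have M0 : 0 <= M by apply: le_trans (gM 0 _); rewrite ?normr_ge0 // lexx ltr01.
have de0 : 0 <= d^-1 + 32 * M / e.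
  by rewrite addr_ge0 ?invr_ge0 ?divr_ge0 ?mulr_ge0 // ltW.
(* The term [d^-1] makes the third piece shorter than [d], and [32 * M / e] makes the error
   [8 * (2 * M) / k.+2%:R] at most [e / 2]. The successor excludes level 0, to which [totS_le] does
   not apply. *)
exists (Num.bound (d^-1 + 32 * M / e)).+1 => -[//|k]; rewrite ltnS => Kk x x01 nsx N HN.
have Hk : d^-1 + 32 * M / e < k.+1%:R.
  by apply: lt_le_trans (archi_boundP de0) _; rewrite ler_nat (leq_trans Kk).
have kd : k.+1%:R^-1 <= d.
  rewrite invf_ple ?posrE //; have : 0 <= 32 * M / e by rewrite divr_ge0 ?mulr_ge0 // ltW.
  lra.
have ke : 16 * M / k.+2%:R <= e / 2.
  rewrite ler_pdivrMr // -(natr1 k.+1).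
  have d0' : 0 <= d^-1 by rewrite invr_ge0 ltW.
  have : 32 * M / e <= k.+1%:R by lra.
  rewrite ler_pdivrMr //; nra.
set nu := tower_mean g k.+1; pose g' y := g y - nu.
have nuM : `|nu| <= M by exact: tower_mean_le.
have N0 : 0 < N%:R :> R.
  by case/andP: HN => HN _; rewrite ltr0n; exact: leq_trans (horizon_gt0 _) HN.
have h0 : 0 < (h k.+1 L3)%:R :> R by rewrite ltr0n kh_gt0.
have Hs : `|birkhoff D g' N (T x)| <= N%:R * (e / 2 + 8 * (2 * M) / k.+2%:R).
  { apply: (@birkhoff_shadow _ D k.+1) => // [y y01||y y3].
  - have := ler_normB (g y) nu; have := gM y y01; rewrite /g'; lra.
  - by rewrite divr_ge0 // ltW.
  - rewrite birkhoffB /nu /tower_mean (mulrC _ (_ / _)) divfK ?gt_eqF // /birkhoff -sumrB.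
    apply: le_trans (ler_norm_sum _ _ _) _.
    apply: (@le_trans _ _ (\sum_(i < h k.+1 L3) e / 2)); last first.
      by rewrite sumr_const card_ord mulr_natr.
    apply: ler_sum => i _; apply: gd.
    + exact/iter_ket_itv/piece_itv/y3.
    + exact/iter_ket_itv/piece_itv/piece_pleft.
    + have E := level_shift y3 (piece_pleft D k.+1 L3) (ltnW (ltn_ord i)).
      rewrite (_ : _ - _ = y - pleft D k.+1 L3); last by lra.
      apply: le_trans (in_itv_dir_dist y3 (piece_pleft D k.+1 L3)) _.
      rewrite (_ : _ - _ = kl D k.+1 L3); last by ring.
      exact: le_trans (le_trans (kl_le_tot _ _ _) (totS_le _ _)) kd. }
rewrite birkhoffB in Hs.
rewrite (_ : _ - nu = N%:R^-1 * (birkhoff D g N (T x) - N%:R * nu)); last first.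
  by rewrite mulrBr mulKf ?gt_eqF.
rewrite normrM gtr0_norm ?invr_gt0 // ler_pdivrMl //.
apply: le_trans Hs _; rewrite ler_pM2l //.
rewrite [leRHS](splitr e) lerD2l; apply: le_trans ke.
by rewrite mulrA -natrM.
Qed.

(** Invariance lets a Birkhoff average over one horizon replace [g] under the integral. It is close
    to [tower_mean g k] except on the cover [C] of the level-(k+1) shadow, where the error is at
    most [2 * M] and the measure at most [2 ^- k.+1]. *)
Lemma integral_approx A g M : invariant_set D A -> bounded_measurable g M ->
  uniform_on_unit g -> forall e, 0 < e -> exists K, forall k, (K <= k)%N ->
  `|\int[mu]_(x in A) g x - fine (mu A) * tower_mean g k| <= e.
Proof.
move=> iA bg ug e e0; have [mA A01 _] := iA.
have gM x : 0 <= x < 1 -> `|g x| <= M by case: bg.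
have M0 : 0 <= M by apply: le_trans (gM 0 _); rewrite ?normr_ge0 // lexx ltr01.
have muA : (mu A <= 1)%E by exact: lebesgue_finite.
have muAf : mu A \is a fin_num by rewrite ge0_fin_numE // (le_lt_trans muA) // ltry.
have [K HK] := birkhoff_approx gM ug (divr_gt0 e0 (ltr0Sn _ 1)).
have Me0 : 0 <= 4 * M / e by rewrite divr_ge0 ?mulr_ge0 // ltW.
exists (maxn K (Num.bound (4 * M / e))) => k; rewrite geq_max => /andP[Kk Bk].
set nu := tower_mean g k; have nuM : `|nu| <= M by exact: tower_mean_le.
pose N := horizon (h k) k; have N0 : 0 < N%:R :> R by rewrite ltr0n horizon_gt0.
pose F x := N%:R^-1 * birkhoff D g N (T x).
pose C : set (measurableTypeR R) := intervals (shadow_lefts D k.+1) (rho D k.+1).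
have mC : measurable C by exact: measurable_intervals.
have bF : bounded_measurable F M.
  have [mb bb] := bounded_measurable_birkhoff D N bg; split.
    by apply: measurable_funM => //; exact: measurable_cst.
  by move=> x; rewrite normrM gtr0_norm ?invr_gt0 // ler_pdivrMl //.
have bC : bounded_measurable (\1_C : R -> R) 1.
  split; first exact: measurable_indic.
  by move=> x; rewrite indicE; case: (x \in C); rewrite ?normr1 ?normr0.
have bcst c : bounded_measurable (fun=> c : R) `|c|.
  by split => //; exact: measurable_cst.
have iF := bounded_integrable A01 mA bF.
have HF x : A x -> `|F x - nu| <= e / 2 + 2 * M * \1_C x.
  move=> /A01; rewrite /= in_itv /= => x01; rewrite indicE; have [xC|xC] := boolP (x \in C).
    have [_ /(_ x) Fx] := bF; have := ler_normB (F x) nu; rewrite mulr1; lra.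
  rewrite mulr0 addr0; apply: HK => //.
    by move/shadow_intervals; rewrite (negbTE xC).
  by rewrite leqnn horizon_le.
have -> : \int[mu]_(x in A) g x = \int[mu]_(x in A) F x.
  rewrite RintegralZl //; last exact: (bounded_integrable A01 mA (bounded_measurable_birkhoff D N bg)).
  by rewrite (integral_birkhoff N iA bg) mulKf // gt_eqF.
have inu := bounded_integrable A01 mA (bcst nu).
rewrite mulrC -(Rintegral_cst mu mA) -RintegralB //.
have bFnu : bounded_measurable (fun x => F x - nu) (M + M).
  have [mF FM] := bF; split; first by apply: measurable_funB => //; exact: measurable_cst.
  by move=> x; have := ler_normB (F x) nu; have := FM x; lra.
apply: le_trans (le_normr_Rintegral mA (bounded_integrable A01 mA bFnu)) _.
have bR : bounded_measurable (fun x => e / 2 + 2 * M * \1_C x) (e / 2 + 2 * M).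
  have [m1 C1] := bC; split.
    apply: measurable_funD; first exact: measurable_cst.
    by apply: measurable_funM => //; exact: measurable_cst.
  move=> x; rewrite indicE; case: (x \in C); rewrite ?mulr1 ?mulr0 ?addr0 ger0_norm; lra.
apply: le_trans (le_Rintegral mA _ (bounded_integrable A01 mA bR) HF) _.
  have [mFn FnM] := bFnu; apply: (@bounded_integrable _ A (fun x => `|F x - nu|) (M + M)) => //.
  split; first exact: measurableT_comp.
  by move=> x; rewrite normr_id.
rewrite RintegralD //; last 2 first.
{ exact: (bounded_integrable A01 mA (bcst (e / 2))). }
{ apply: (@bounded_integrable _ A (fun x => 2 * M * \1_C x) (2 * M)) => //; split.
    by apply: measurable_funM; [exact: measurable_cst|case: bC].
  by move=> x; rewrite indicE; case: (x \in C); rewrite ?mulr1 ?mulr0 ?ger0_norm //; lra. }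
rewrite Rintegral_cst // RintegralZl //; last exact: (bounded_integrable A01 mA bC).
have muA1 : fine (mu A) <= 1 by rewrite -lee_fin fineK.
have muA0 : 0 <= fine (mu A) by rewrite fine_ge0.
have IC : \int[mu]_(x in A) \1_C x <= 2 ^- k.+1.
  rewrite /Rintegral integral_indic //.
  have HC : (mu (C `&` A) <= (2 ^- k.+1)%:E)%E.
    apply: le_trans (lebesgue_shadow_cover D k.+1); apply: le_measure; rewrite ?inE //.
    exact: measurableI.
  rewrite -lee_fin fineK // ge0_fin_numE //; apply: le_lt_trans HC _; exact: ltry.
have k2 : k%:R <= 2 ^+ k.+1 :> R.
  by rewrite -natrX ler_nat; apply: ltnW; apply: ltn_trans (ltn_expl k (isT : 1 < 2)%N) _; rewrite ltn_exp2l.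
have kM : 4 * M / e <= k%:R.
  by apply: le_trans (ltW (archi_boundP Me0)) _; rewrite ler_nat.
have Q : 2 * M * 2 ^- k.+1 <= e / 2.
  rewrite ler_pdivrMr ?exprn_gt0 //; rewrite ler_pdivrMr // in kM; nra.
have : 2 * M * \int[mu]_(x in A) \1_C x <= 2 * M * 2 ^- k.+1 by apply: ler_wpM2l => //; lra.
have : e / 2 * fine (mu A) <= e / 2 * 1 by apply: ler_wpM2l; lra.
lra.
Qed.

(** The constants [tower_mean g k] are the same for [A] and for the whole interval. *)
Lemma integral_invariant_set A g M : invariant_set D A -> bounded_measurable g M ->
  uniform_on_unit g ->
  \int[mu]_(x in A) g x = fine (mu A) * \int[mu]_(x in `[0, 1[) g x.
Proof.
move=> iA bg ug; have [mA A01 _] := iA.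
have muA1 : fine (mu A) <= 1.
  have muA := lebesgue_finite A01 mA.
  by rewrite -lee_fin fineK // ge0_fin_numE // (le_lt_trans muA) // ltry.
have muA0 : 0 <= fine (mu A) by rewrite fine_ge0.
apply/eqP; rewrite -subr_eq0 -normr_le0; apply/ler_addgt0Pr => e e0; rewrite add0r.
have [K1 HK1] := integral_approx iA bg ug (divr_gt0 e0 (ltr0Sn _ 1)).
have [K2 HK2] := integral_approx (invariant_set_itv D) bg ug (divr_gt0 e0 (ltr0Sn _ 1)).
pose k := maxn K1 K2.
have := HK1 k (leq_maxl _ _); have := HK2 k (leq_maxr _ _).
have -> : fine (mu `[0, 1[%classic) = 1 by rewrite lebesgue_unit.
rewrite mul1r; set I1 := Rintegral _ _ _; set I2 := Rintegral _ _ _; set nu := tower_mean g k.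
move=> H1 H2.
have H3 : fine (mu A) * `|I1 - nu| <= e / 2.
  by apply: le_trans H1; rewrite ler_piMl.
rewrite (_ : _ - _ = (I2 - fine (mu A) * nu) - fine (mu A) * (I1 - nu)); last by ring.
by apply: le_trans (ler_normB _ _) _; rewrite normrM (ger0_norm muA0); lra.
Qed.

Lemma tower_mean_cvg g M : bounded_measurable g M -> uniform_on_unit g ->
  forall e, 0 < e -> exists K, forall k, (K <= k)%N ->
  `|\int[mu]_(x in `[0, 1[) g x - tower_mean g k| <= e.
Proof.
move=> bg ug e e0; have [K HK] := integral_approx (invariant_set_itv D) bg ug e0.
exists K => k /HK.
have -> : fine (mu `[0, 1[%classic) = 1 by rewrite lebesgue_unit.
by rewrite mul1r.
Qed.

Lemma horizon_bracket K N : (horizon (h K) K <= N)%N -> exists2 k, (K <= k)%N &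
  (horizon (h k) k <= N <= horizon (h k.+1) k.+1)%N.
Proof.
move=> KN; have [|m /andP[Km Nm] mmin] := @ex_minnP (fun k => (K <= k) && (N < horizon (h k) k))%N.
  exists N; rewrite horizon_gt andbT; apply: leq_trans KN; exact: ltnW (horizon_gt K).
case: m Km Nm mmin => [|m] Km Nm mmin.
  by move: Km KN Nm; rewrite leqn0 => /eqP ->; rewrite leqNgt => /negbTE ->.
move: Km; rewrite leq_eqVlt => /orP[/eqP Km|Km].
  by move: KN Nm; rewrite Km leqNgt => /negbTE ->.
exists m => //; rewrite (ltnW Nm) andbT leqNgt; apply/negP => Nm'.
by have := mmin m; rewrite Nm' andbT -ltnS Km ltnn => /(_ isT).
Qed.

Lemma generic_good x : 0 <= x < 1 ->
  (exists K, forall k, (K <= k)%N -> ~ shadow D k x) -> generic_point T mu x.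
Proof.
move=> x01 [K0 HK0] f cf.
have [M bg] := within_continuous_bounded cf.
pose g := f \_ `[0, 1]; have gE y : 0 <= y < 1 -> g y = f y.
  by move=> /andP[y0 y1]; rewrite /g patchE mem_set //= in_itv /= y0 ltW.
have ug : uniform_on_unit g.
  move=> e e0; have [d d0 Hd] := within_continuous_uniform cf e0.
  by exists d => // y z y01 z01; rewrite !gE //; exact: Hd.
have -> : \int[mu]_(t in `[0, 1[) f t = \int[mu]_(t in `[0, 1[) g t.
  by apply: eq_Rintegral => y; rewrite inE /= in_itv /= => /gE.
apply/cvgrPdist_le => e e0.
have gM y : 0 <= y < 1 -> `|g y| <= M by case: bg.
have [K1 HK1] := tower_mean_cvg bg ug (divr_gt0 e0 (ltr0Sn _ 1)).
have [K2 HK2] := birkhoff_approx gM ug (divr_gt0 e0 (ltr0Sn _ 1)).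
pose K := maxn K0 (maxn K1 K2).
exists (horizon (h K) K) => // N /= KN.
have [k Kk kN] := horizon_bracket KN.
move: (Kk); rewrite !geq_max => /and3P[K0k K1k K2k].
have H1 := HK1 k K1k.
have H2 := HK2 k K2k x x01 (HK0 k.+1 (leqW K0k)) N kN.
have -> : \sum_(1 <= n < N.+1) f (iter n T x) = birkhoff D g N (T x).
  rewrite big_add1 /= big_mkord /birkhoff; apply: eq_bigr => i _.
  have xi : 0 <= iter i T (T x) < 1 by apply: iter_ket_itv; exact: ket_itv.
  by rewrite gE // -iterSr.
set I := Rintegral _ _ _ in H1 *; set B := _ * _ in H2 *; set nu := tower_mean _ _ in H1 H2.
rewrite (_ : I - B = (I - nu) - (B - nu)); last by ring.
by apply: le_trans (ler_normB _ _) _; lra.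
Qed.

Lemma nongeneric_dim0 :
  hausdorff_dim (`[0, 1[ `\` [set x | generic_point T mu x]) = 0%E.
Proof.
apply: (@hausdorff_dim_eq0 R _ (shadow_lefts D) (kQ D)).
- exact: kQ_ge4.
- move=> k; apply: leq_trans (kQ_cover D k).
  by rewrite leq_mul2l size_shadow_lefts orbT.
- move=> K x [/=]; rewrite in_itv /= => x01 ngx.
  apply: contrapT => nx; apply: ngx; apply: generic_good => //.
  exists K => k Kk /shadow_intervals xk; apply: nx; exists k => //.
  by move: xk; rewrite inE.
Qed.

Lemma ket_ergodic : ergodic_measure T mu.
Proof.
split; first exact: lebesgue_invariant.
move=> A mA A01 AT.
have iA : invariant_set D A by [].
have muA := lebesgue_finite A01 mA.
have muAf : mu A \is a fin_num by rewrite ge0_fin_numE // (le_lt_trans muA) // ltry.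
have mE : measurable (`[0, 1[%classic : set (measurableTypeR R)) by exact: measurable_itv.
have muE := @lebesgue_unit R.
have bA : bounded_measurable (\1_A : R -> R) 1.
  split; first exact: measurable_indic.
  by move=> x; rewrite indicE; case: (x \in A); rewrite ?normr1 ?normr0.
have AE : A `<=` `[0, 1[ by [].
have [g_ [gc gi gl]] : exists g_ : (R -> R)^nat, [/\ forall n, continuous (g_ n),
    forall n, mu.-integrable `[0, 1[ (EFin \o g_ n) &
    (\int[mu]_(z in `[0%R, 1%R[) `|(\1_A z - g_ n z)%:E| @[n --> \oo] --> 0)%E].
  have fE : (mu `[0%R, 1%R[%classic < +oo)%E by rewrite muE ltry.
  exact: (approximation_continuous_integrable mE fE (bounded_integrable (@subset_refl _ _) mE bA)).
have muA1 : fine (mu A) <= 1 by rewrite -lee_fin fineK.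
have muA0 : 0 <= fine (mu A) by rewrite fine_ge0.
(* For [g] continuous and close to the indicator of [A] in mean, mu(A) is close to the integral of
   [g] over [A], which is mu(A) times the full integral of [g], itself close to mu(A). *)
have key : fine (mu A) = fine (mu A) * fine (mu A).
  apply/eqP; rewrite -subr_eq0 -normr_le0; apply/ler_addgt0Pr => e e0; rewrite add0r.
  have e20 := divr_gt0 e0 (ltr0Sn R 1).
  have [n Hn] : exists n, \int[mu]_(z in `[0, 1[) `|\1_A z - g_ n z| <= e / 2.
    have /fine_cvgP[_ /cvgrPdist_le /(_ _ e20)[n _ Hn]] := gl.
    exists n; have := Hn n (leqnn n); rewrite sub0r normrN; apply: le_trans.
    exact: ler_norm.
  have cg : {within `[0, 1], continuous (g_ n)} by apply: continuous_subspaceT; exact: gc.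
  have [M bg] := within_continuous_bounded cg.
  pose g := g_ n \_ `[0, 1]; have gE y : 0 <= y < 1 -> g y = g_ n y.
    by move=> /andP[y0 y1]; rewrite /g patchE mem_set //= in_itv /= y0 ltW.
  have ug : uniform_on_unit g.
    move=> c c0; have [d d0 Hd] := within_continuous_uniform cg c0.
    by exists d => // y z y01 z01; rewrite !gE //; exact: Hd.
  have bd : bounded_measurable (fun x => `|\1_A x - g x|) (1 + M).
    have [mg gM] := bg; have [m1 h1] := bA; split.
      by apply: measurableT_comp => //; exact: measurable_funB.
    move=> x; rewrite normr_id; have := ler_normB (\1_A x : R) (g x).
    by have := h1 x; have := gM x; lra.
  have sub_le (B : set (measurableTypeR R)) : measurable B -> B `<=` `[0, 1[ ->
      `|\int[mu]_(x in B) \1_A x - \int[mu]_(x in B) g x| <= e / 2.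
    move=> mB B01.
    rewrite -RintegralB //; [|exact: (bounded_integrable B01 mB bA)
                             |exact: (bounded_integrable B01 mB bg)].
    apply: le_trans (le_normr_Rintegral mB _) _.
      have [mg gM] := bg; have [m1 h1] := bA.
      apply: (@bounded_integrable _ B (fun x => \1_A x - g x) (1 + M)) => //; split.
        exact: measurable_funB.
      move=> x; have := ler_normB (\1_A x : R) (g x); have := h1 x; have := gM x; lra.
    apply: le_trans Hn.
    have -> : \int[mu]_(z in `[0, 1[) `|\1_A z - g_ n z| =
        \int[mu]_(z in `[0, 1[) `|\1_A z - g z|.
      by apply: eq_Rintegral => x; rewrite inE /= in_itv /= => /gE ->.
    have finB (C : set (measurableTypeR R)) : measurable C -> C `<=` `[0, 1[ ->
        (\int[mu]_(x in C) (`|\1_A x - g x|%R)%:E)%E \is a fin_num.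
      by move=> mC C01; exact: (integrable_fin_num mC (bounded_integrable C01 mC bd)).
    apply: fine_le; [exact: finB|exact: finB|].
    apply: ge0_subset_integral => //; apply/measurable_EFinP.
    by apply: measurable_funTS; case: bd.
  have I1 (B : set (measurableTypeR R)) : measurable B -> \int[mu]_(x in B) \1_A x = fine (mu (A `&` B)).
    by move=> mB; rewrite /Rintegral integral_indic.
  have := sub_le A mA A01; have := sub_le _ mE (@subset_refl _ _).
  rewrite !I1 // setIid (setIidl A01) (integral_invariant_set iA bg ug).
  set I := Rintegral _ _ _; move=> H1 H2.
  have H3 : fine (mu A) * `|fine (mu A) - I| <= e / 2 by apply: le_trans H1; rewrite ler_piMl.
  rewrite (_ : _ - _ = (fine (mu A) - fine (mu A) * I) - fine (mu A) * (fine (mu A) - I)); last by ring.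
  by apply: le_trans (ler_normB _ _) _; rewrite normrM (ger0_norm muA0); lra.
have : fine (mu A) * (1 - fine (mu A)) = 0 by rewrite mulrBr mulr1 -key subrr.
move/eqP; rewrite mulf_eq0 subr_eq0 => /orP[/eqP A0|/eqP A1].
  by left; apply: etrans (esym (fineK muAf)) _; rewrite A0.
have fE : (mu `[0%R, 1%R[%classic < +oo)%E by rewrite muE ltry.
right; apply: etrans (measureD mE mA fE) _.
suff : (mu `[0%R, 1%R[%classic - mu (`[0%R, 1%R[%classic `&` A) = 0)%E by [].
by rewrite muE (setIidr A01) -(fineK muAf) -A1 -EFinB subrr.
Qed.

End keane_generic.

(** * A second invariant measure *)

Section distribution_function.
Context {R : realType} (F : R -> R).
Hypothesis F_homo : {homo F : x y / x <= y}.
Hypothesis F_cont : forall e : R, 0 < e -> exists2 d, 0 < d & forall x, F (x + d) <= F x + e.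
Hypothesis F_le0 : forall x, x <= 0 -> F x = 0.
Hypothesis F_ge1 : forall x, 1 <= x -> F x = 1.

(** The Stieltjes measure is given on intervals closed on the right. [F_cont] rules out atoms, so
    the closed end may be moved to the left. *)
Lemma distribution_measure : exists P : probability (measurableTypeR R) R,
  forall u v, u <= v -> P `[u, v[%classic = (F v - F u)%:E.
Proof.
have rc : right_continuous F.
  move=> x; apply/cvgrPdist_le => e e0; have [d d0 Hd] := F_cont e0.
  near=> y.
  have xy : x <= y by near: y; exact: nbhs_right_ge.
  have yd : y <= x + d by near: y; apply: nbhs_right_le; rewrite ltrDl.
  rewrite distrC ger0_norm ?subr_ge0 ?F_homo //.
  have := Hd x; have := F_homo yd; lra.
pose c1 := @isCumulative.Build R _ R F F_homo rc.
have cNy : F @ -oo --> (0 : R).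
  apply: cvg_near_cst; exists 0; split; first exact: real0.
  by move=> x x0; apply: F_le0; exact: ltW.
have cy : F @ +oo --> (1 : R).
  apply: cvg_near_cst; exists 1; split; first exact: real1.
  by move=> x x0; apply: F_ge1; exact: ltW.
pose c2 := @isCumulativeBounded.Build R 0 1 F cNy cy.
pose G : cumulativeBounded (0 : R) 1 := HB.pack F c1 c2.
pose P : probability (measurableTypeR R) R := lebesgue_stieltjes_measure G.
have Poc u v : u <= v -> P `]u, v]%classic = (F v - F u)%:E.
  move=> uv; rewrite /P /= /lebesgue_stieltjes_measure /measure_extension.
  rewrite measurable_mu_extE /=; last exact: is_ocitv.
  by rewrite wlength_itv_bnd.
have P1 u : P [set u] = 0%E.
  apply/eqP; rewrite eq_le measure_ge0 andbT; apply/lee_addgt0Pr => e e0; rewrite add0e.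
  have [d d0 Hd] := F_cont e0.
  apply: (@le_trans _ _ (P `]u - d, u]%classic)).
    apply: le_measure; rewrite ?inE; [exact: measurable_set1 | exact: measurable_itv | ].
    by move=> _ ->; rewrite /= in_itv /= lexx ltrBlDr ltrDl d0.
  rewrite Poc; last by rewrite gerBl ltW.
  rewrite lee_fin.
  by have := Hd (u - d); rewrite subrK; lra.
exists P => u v; rewrite le_eqVlt => /orP[/eqP ->|uv].
  by rewrite subrr set_itvco0 measure0.
have m1 x : measurable ([set x] : set (measurableTypeR R)) by exact: measurable_set1.
have mco : measurable (`[u, v[%classic : set (measurableTypeR R)) by exact: measurable_itv.
have moc : measurable (`]u, v]%classic : set (measurableTypeR R)) by exact: measurable_itv.
transitivity (P `[u, v]%classic).
  rewrite -(@setUitv1 _ _ (BLeft u) v true) ?bnd_simp ?ltW // measureU //.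
    by apply: etrans (esym (adde0 _)) _; congr (_ + _)%E; exact: esym (P1 v).
  apply/seteqP; split=> // z [/=]; rewrite in_itv /= => /andP[_ zv] zE.
  by move: zv; rewrite zE ltxx.
rewrite -(setU1itv false) ?bnd_simp ?ltW // measureU //.
  exact: etrans (congr2 (fun a b : \bar R => (a + b)%E) (P1 u) (Poc _ _ (ltW uv))) (add0e _).
apply/seteqP; split=> // z [/=] ->; by rewrite in_itv /= ltxx.
Unshelve. all: by end_near. Qed.

End distribution_function.

(** One ultrafilter serves all sequences in [0, 1] at once. This replaces a diagonal extraction,
    which would not reach uncountably many sequences, and properties that hold eventually still pass
    to the limit. *)
Lemma ultrafilter_limits (R : realType) : exists U : set_system nat,
  [/\ ProperFilter U, (\oo : set_system nat) `<=` U &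
   forall u : nat -> R, (forall k, 0 <= u k <= 1) -> exists l : R, u @ U --> l].
Proof.
have [U [UU oU]] := @ultraFilterLemma nat \oo _.
exists U; split=> //; first exact: ultra_proper.
move=> u u01.
have UP : ProperFilter U := @ultra_proper _ _ UU.
have Ku : (u @ U) `[0, 1]%classic.
  suff : U (u @^-1` `[0, 1]%classic) by [].
  by apply: filterS (@filterT _ U _) => k _; suff : u k \in `[0, 1] by []; rewrite in_itv u01.
have [l [_ cl]] := @segment_compact R 0 1 (u @ U) _ Ku.
exists l => V Vl; have [//|UnV] := in_ultra_setVsetC (u @^-1` V) UU.
have [z [/= nVz Vz]] := cl (~` V) V UnV Vl.
by case: nVz.
Qed.

Section keane_second_measure.
Context {R : realType} (D : keane R).
Implicit Types (i k n N : nat) (j : letter) (x y u v : R) (g : R -> R).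
Notation T := (ket D).
Notation h := (kh D).
Notation l := (kl D).

Definition inside u v y : R := ((u <= y) && (y < v))%:R.

Lemma inside_itv u v y : 0 <= inside u v y <= 1.
Proof. by rewrite ler0n lern1 leq_b1. Qed.

(* By minimality, a periodic orbit would be a finite set dense in [0, 1). *)
Lemma ket_aperiodic i x : 0 <= x < 1 -> (0 < i)%N -> iter i T x != x.
Proof.
move=> x01 i0; apply/eqP => Tix.
have orb n : exists2 m, (m < i)%N & iter n T x = iter m T x.
  elim: n => [|n [m mi E]]; first by exists 0%N.
  have [mi'|im] := ltnP m.+1 i; first by exists m.+1; rewrite // !iterS E.
  exists 0%N => //; rewrite iterS E -iterS (_ : m.+1 = i) //.
  by apply/eqP; rewrite eqn_leq mi im.
pose O : set R := [set iter m T x | m in `I_i].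
have finO : finite_set O by apply: finite_image; exact: finite_II.
have OE : range (fun n => iter n T x) `<=` O.
  by move=> _ [n _ <-]; have [m mi ->] := orb n; exists m.
have sub : `[0, 1[%classic `<=` O.
  have x01' : x \in `[0, 1[ by rewrite in_itv.
  apply: subset_trans (@ket_minimal R D x x01') _.
  apply: subset_trans (closure_subset OE) _.
  have /closure_id <- // : closed O.
  exact: (accessible_finite_set_closed.1 (hausdorff_accessible (@norm_hausdorff R R)) O finO).
have mO : measurable (O : set (measurableTypeR R)).
  exact: countable_measurable (finite_set_countable finO).
have : (lebesgue_measure (`[0%R, 1%R[%classic : set (measurableTypeR R)) <=
        lebesgue_measure (O : set (measurableTypeR R)))%E.
  by apply: le_measure; rewrite ?inE //; exact: measurable_itv.
rewrite (countable_lebesgue_measure0 (finite_set_countable finO)).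
by rewrite lebesgue_unit lee_fin ler10.
Qed.

Lemma seq_separation (s : seq R) : exists2 d : R, 0 < d & forall z, z \in s -> z != 0 -> d <= `|z|.
Proof.
elim: s => [|a s [d d0 Hd]]; first by exists 1.
have [->|a0] := eqVneq a 0.
  by exists d => // z; rewrite in_cons => /orP[/eqP ->|/Hd //]; rewrite eqxx.
exists (Num.min d `|a|); first by rewrite lt_min d0 normr_gt0.
move=> z; rewrite in_cons ge_min => /orP[/eqP ->|zs z0]; first by rewrite lexx orbT.
by rewrite Hd.
Qed.

(* T^i x - x takes finitely many values, none of them 0. *)
Lemma return_separation n : exists2 d : R, 0 < d &
  forall i x, 0 <= x < 1 -> (0 < i <= n)%N -> d <= `|iter i T x - x|.
Proof.
have [d d0 Hd] := seq_separation (flatten [seq shifts D i | i <- iota 0 n.+1]).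
exists d => // i x x01 /andP[i0 iN]; have := ket_aperiodic x01 i0.
have [s ss ->] := iter_shifts D i x; rewrite -subr_eq0 (addrC x) addrK => s0.
by apply: Hd => //; apply/flatten_mapP; exists i => //; rewrite mem_iota.
Qed.

Lemma birkhoffS g n x : birkhoff D g n.+1 x = g x + birkhoff D g n (T x).
Proof.
by rewrite -add1n birkhoffD /birkhoff big_ord1.
Qed.

Lemma birkhoff_ge0 g n x : (forall y, 0 <= g y) -> 0 <= birkhoff D g n x.
Proof. by move=> g0; apply: sumr_ge0 => i _. Qed.

(* Two visits to an interval of length [d] are more than [n] steps apart. *)
Lemma birkhoff_inside_le n d x : (0 < n)%N ->
  (forall i y, 0 <= y < 1 -> (0 < i <= n)%N -> d <= `|iter i T y - y|) ->
  forall N y, 0 <= y < 1 -> birkhoff D (inside x (x + d)) N y <= N%:R / n%:R + 1.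
Proof.
move=> n0 Hd; have n0' : 0 < n%:R :> R by rewrite ltr0n.
have short N y : (N <= n)%N -> 0 <= y < 1 -> birkhoff D (inside x (x + d)) N y <= 1.
  elim: N y => [|N IHN] y Nn y01; first by rewrite /birkhoff big_ord0.
  rewrite birkhoffS; have [Hy|Hy] := boolP ((x <= y) && (y < x + d)); last first.
    by rewrite [inside _ _ y]/inside (negbTE Hy) add0r IHN // ?ket_itv // ltnW.
  rewrite [inside _ _ y]/inside Hy.
  suff -> : birkhoff D (inside x (x + d)) N (T y) = 0 by rewrite addr0.
  apply: big1 => i _; rewrite -iterSr /inside.
  case: (boolP (_ && _)) => // Hi.
  have : d <= `|iter i.+1 T y - y| by apply: Hd => //; exact: leq_trans (ltn_ord i) (ltnW Nn).
  by rewrite leNgt ltr_norml; case/negP; lra.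
have main m : forall N y, (N <= m)%N -> 0 <= y < 1 ->
    birkhoff D (inside x (x + d)) N y <= N%:R / n%:R + 1.
  elim: m => [|m IHm] N y Nm y01.
    by move: Nm; rewrite leqn0 => /eqP ->; rewrite /birkhoff big_ord0 mul0r add0r ler01.
  have [Nn|nN] := leqP N n.
    by apply: le_trans (short _ _ Nn y01) _; rewrite lerDr divr_ge0.
  have -> : N = (n + (N - n))%N by rewrite subnKC // ltnW.
  rewrite birkhoffD.
  have H1 := short n y (leqnn _) y01.
  have H2 : birkhoff D (inside x (x + d)) (N - n) (iter n T y) <= (N - n)%:R / n%:R + 1.
    by apply: IHm; [lia|exact: iter_ket_itv].
  rewrite natrD mulrDl mulfV ?gt_eqF //; lra.
by move=> N y; exact: main.
Qed.

Lemma inside_exchange j u v y : lft D 0 j <= u -> v <= lft D 0 j + l 0 j -> 0 <= y < 1 ->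
  inside (u + tau D 0 j) (v + tau D 0 j) (T y) = inside u v y.
Proof.
move=> ju vj; rewrite -(section0E D) => /section_piece[i iy].
rewrite (ket_piece iy) /inside; congr (_%:R); congr nat_of_bool.
have [g1 g2 g3 g4] := kl_gt0s D 0.
move: iy; rewrite /piece /in_itv_dir /= !add0r => iy.
by case: i iy; case: j ju vj => /= ju vj iy; apply/idP/idP; lra.
Qed.

(** The distribution function of the empirical measure of one passage through the second tower. *)
Definition count_below x k : R :=
  birkhoff D (fun y => (y < x)%R%:R) (h k L2) (pleft D k L2) / (h k L2)%:R.

Let p01 k : 0 <= pleft D k L2 < 1 := piece_itv (piece_pleft D k L2).

Let h0 k : 0 < (h k L2)%:R :> R.
Proof. by rewrite ltr0n kh_gt0. Qed.

Lemma count_below_itv x k : 0 <= count_below x k <= 1.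
Proof.
rewrite /count_below divr_ge0 //=; last by apply: birkhoff_ge0 => y; rewrite ler0n.
rewrite ler_pdivrMr // mul1r (le_trans (ler_norm _)) //.
rewrite -[leRHS]mul1r; apply: birkhoff_le (p01 k) => y _.
by case: (y < x); rewrite ?normr1 ?normr0.
Qed.

Lemma count_below_diff u v k : u <= v -> count_below v k - count_below u k =
  birkhoff D (inside u v) (h k L2) (pleft D k L2) / (h k L2)%:R.
Proof.
move=> uv; rewrite /count_below -mulrBl /birkhoff -sumrB; congr (_ / _).
apply: eq_bigr => i _; rewrite /inside; set z := iter _ _ _.
by case: (ltP z v); case: (ltP z u) => /= ? ?; rewrite ?subrr ?subr0 //; lra.
Qed.

(* The two counts run over orbit segments that differ by one step. *)
Lemma count_below_exchange j u v k :
  lft D 0 j <= u -> u <= v -> v <= lft D 0 j + l 0 j ->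
  `|(count_below (v + tau D 0 j) k - count_below (u + tau D 0 j) k)
    - (count_below v k - count_below u k)| <= (h k L2)%:R^-1.
Proof.
move=> ju uv vj; rewrite !count_below_diff ?lerD2r // -mulrBl normrM normfV (gtr0_norm (h0 k)).
rewrite -[leRHS]mul1r ler_pM2r ?invr_gt0 //.
set I' := inside (u + _) _; set p := pleft D k L2; set n := h k L2.
have -> : birkhoff D (inside u v) n p = birkhoff D I' n (T p).
  apply: eq_bigr => i _; rewrite -iterSr /= /I' inside_exchange //.
  exact/iter_ket_itv/p01.
have E : birkhoff D I' n p + I' (iter n T p) = I' p + birkhoff D I' n (T p).
  by rewrite -birkhoffS -addn1 birkhoffD /birkhoff big_ord1.
have := inside_itv (u + tau D 0 j) (v + tau D 0 j) p.
have := inside_itv (u + tau D 0 j) (v + tau D 0 j) (iter n T p).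
rewrite -/I' ler_norml; lra.
Qed.

Lemma kh_L2S k : h k.+1 L2 =
  (h k L4 + (kp D k).+1 * h k L2 + (kq D k).+1 * h k L3)%N.
Proof. by rewrite khS /= map_cat sumn_cat /= !map_nseq !sumn_nseq; lia. Qed.

Lemma kh_L2_ge k : (k < h k.+1 L2)%N.
Proof.
apply: (@leq_trans (2 ^ k.+2)).
  by apply: ltn_trans (ltn_expl k (isT : 1 < 2)%N) _; rewrite ltn_exp2l.
apply: (@leq_trans (kp D k * h k L2)).
  apply: leq_trans (kp_large D k); rewrite leq_pmulr // addn_gt0 kh_gt0 //.
by rewrite kh_L2S mulSn -!addnA (leq_trans _ (leq_addl _ _)) // addnCA leq_addr.
Qed.

Lemma kh_L2_inv_lt e : 0 < e -> exists K, forall k, (K <= k)%N -> (h k L2)%:R^-1 <= e :> R.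
Proof.
move=> e0; exists (Num.bound e^-1).+1 => -[//|k]; rewrite ltnS => Kk.
rewrite invf_ple ?posrE //; apply: ltW; apply: lt_le_trans (archi_boundP _) _.
  by rewrite invr_ge0 ltW.
by rewrite ler_nat (leq_trans Kk) // ltnW // kh_L2_ge.
Qed.

Lemma birkhoff_path_ge g c k w x y : (forall z, 0 <= g z) -> 0 <= c ->
  (forall z, piece D k L2 z -> c <= birkhoff D g (h k L2) z) -> path D k w x y ->
  c * (sumn (map (fun j => if j is L2 then 1 else 0)%N w))%:R <= birkhoff D g (wsum D k w) x.
Proof.
move=> g0 c0 gc; elim: w x => [|j w IHw] x; first by rewrite /birkhoff big_ord0 mulr0.
move=> [jx /IHw Hw]; rewrite wsum_cons birkhoffD /= natrD mulrDr lerD //.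
by case: j jx {Hw} => jx; rewrite ?mulr0 ?mulr1 ?birkhoff_ge0 // gc.
Qed.

(* The surplus 2^-(k+1) over 1/2 is halved at each stage: this pays for the letters
   of [word _ _ L2] other than [L2], by [kp_large]. *)
Lemma second_frequency k x : piece D k L2 x ->
  (2^-1 + 2 ^- k.+1) * (h k L2)%:R <=
  birkhoff D (inside (lft D 0 L2) (lft D 0 L3)) (h k L2) x.
Proof.
elim: k x => [|k IHk] x jx.
  rewrite kh0 /birkhoff big_ord1 /inside; move: jx.
  by rewrite /piece /in_itv_dir /= !add0r => ->; rewrite expr1 /=; lra.
have c0 : 0 <= (2^-1 + 2 ^- k.+1) * (h k L2)%:R :> R by rewrite mulr_ge0 // addr_ge0 // invr_ge0 exprn_ge0.
have ins0 z : 0 <= inside (lft D 0 L2) (lft D 0 L3) z by case/andP: (inside_itv (lft D 0 L2) (lft D 0 L3) z).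
have := birkhoff_path_ge ins0 c0 IHk (path_word jx).
rewrite /wsum -khS; apply: le_trans.
have -> : sumn (map (fun j => if j is L2 then 1 else 0)%N (word (kp D k) (kq D k) L2)) = (kp D k).+1.
  by rewrite /= map_cat sumn_cat /= !map_nseq !sumn_nseq; lia.
have Hp := kp_large D k.
rewrite -(ler_nat R) (natrM _ (2 ^ k.+2)%N) (natrM _ (kp D k)) natrX
  (natrD _ (h k L4)) (natrM _ (kq D k).+1) in Hp.
rewrite kh_L2S (natrD _ _ ((kq D k).+1 * h k L3)) (natrD _ (h k L4))
  (natrM _ (kp D k).+1) (natrM _ (kq D k).+1).
set H2 := (h k L2)%:R in Hp *; set Y := (h k L4)%:R in Hp *; set Z := (kq D k).+1%:R * _ in Hp *.
have H20 : 0 <= H2 by rewrite ler0n.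
have YZ0 : 0 <= Y + Z by rewrite addr_ge0 // mulr_ge0.
have -> : 2 ^- k.+2 = 2 ^- k.+1 / 2 :> R by rewrite exprS invfM mulrC.
set t := 2 ^- k.+1.
have t0 : 0 < t by rewrite invr_gt0 exprn_gt0.
have t1 : t <= 2^-1 by rewrite /t exprS invfM ler_piMr // invf_le1 ?exprn_gt0 // exprn_ege1 // ler1n.
have {}Hp : 2 * (Y + Z) <= t * ((kp D k).+1%:R * H2).
  rewrite -ler_pdivrMl // /t invrK mulrA -exprSr.
  by apply: le_trans Hp _; rewrite ler_wpM2r // ler_nat.
set X := (kp D k).+1%:R * H2 in Hp *.
rewrite -mulrA -/(H2 * _) (mulrC H2) -/X.
(* What remains is [(2^-1 + t / 2) * (Y + Z) <= t / 2 * X], where the first factor is at most 1. *)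
nra.
Qed.

(** [F] is the limit of [count_below] along an ultrafilter. The counts fail to be invariant by at
    most the inverse of the tower height, which tends to 0. *)
Lemma second_measure : exists F : R -> R,
  [/\ {homo F : x y / x <= y},
      forall e : R, 0 < e -> exists2 d, 0 < d & forall x, F (x + d) <= F x + e,
      forall x, x <= 0 -> F x = 0,
      forall x, 1 <= x -> F x = 1 &
      (forall j u v, lft D 0 j <= u -> u <= v -> v <= lft D 0 j + l 0 j ->
        F (v + tau D 0 j) - F (u + tau D 0 j) = F v - F u) /\
      2^-1 <= F (lft D 0 L3) - F (lft D 0 L2)].
Proof.
have [U [UP oU Ulim]] := ultrafilter_limits R.
have /choice[F FU] : forall x, exists y : R, count_below x @ U --> y.
  by move=> x; apply: Ulim => k; exact: count_below_itv.
have nearU (P : nat -> Prop) : (exists K, forall k, (K <= k)%N -> P k) -> \forall k \near U, P k.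
  by move=> [K HK]; apply: oU; exists K.
have allU (P : nat -> Prop) : (forall k, P k) -> \forall k \near U, P k.
  by move=> HP; apply: nearU; exists 0%N => k _.
exists F; split.
- move=> x y xy; apply: (ler_cvg_to (FU x) (FU y)); apply: allU => k.
  rewrite -subr_ge0 count_below_diff // divr_ge0 // ?ler0n //.
  by apply: birkhoff_ge0 => z; case/andP: (inside_itv x y z).
- move=> e e0.
  have e20 := divr_gt0 e0 (ltr0Sn R 1).
  (* An interval of length [d] is visited at most [h k L2 / n + 1] times: half of [e] pays for
     [1 / n], the other half for [1 / h k L2]. *)
  pose n := (Num.bound (e / 2)^-1).+1.
  have ne : n%:R^-1 <= e / 2 :> R.
    rewrite invf_ple ?posrE // ltW // /n -natr1.
    by have := archi_boundP (_ : 0 <= (e / 2)^-1); rewrite invr_ge0 ltW // => /(_ isT); lra.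
  have [d d0 Hd] := return_separation n.
  exists d => // x.
  rewrite -lerBlDl; apply: (cvgr_to_le (cvgB (FU (x + d)) (FU x))).
  have [K HK] := kh_L2_inv_lt e20.
  apply: nearU; exists K => k /HK Kk.
  suff : count_below (x + d) k - count_below x k <= e by [].
  rewrite count_below_diff; last by rewrite lerDl ltW.
  rewrite ler_pdivrMr // ?h0 //.
  apply: le_trans (birkhoff_inside_le x _ Hd _ (p01 k)) _ => //.
  have : (h k L2)%:R / n%:R <= (h k L2)%:R * (e / 2) by rewrite ler_wpM2l.
  move: Kk; rewrite invf_ple ?posrE ?h0 // => Kk.
  have : 1 <= (e / 2) * (h k L2)%:R by rewrite mulrC -ler_pdivrMr // div1r.
  lra.
- move=> x x0; apply: (@cvg_unique _ (@norm_hausdorff R R) _ _ _ _ (FU x)).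
  apply: cvg_near_cst; apply: allU => k.
  rewrite /count_below /birkhoff big1 ?mul0r // => i _.
  have /andP[y0 _] := iter_ket_itv D i (p01 k).
  by rewrite ltNge (le_trans x0 y0).
- move=> x x1; apply: (@cvg_unique _ (@norm_hausdorff R R) _ _ _ _ (FU x)).
  apply: cvg_near_cst; apply: allU => k.
  rewrite /count_below /birkhoff.
  have -> : \sum_(i < h k L2) (iter i T (pleft D k L2) < x)%R%:R = (h k L2)%:R :> R.
    rewrite -[in RHS](card_ord (h k L2)) -sum1_card natr_sum; apply: eq_bigr => i _.
    by have /andP[_ y1] := iter_ket_itv D i (p01 k); rewrite (lt_le_trans y1 x1).
  by rewrite divff // gt_eqF ?h0.
- split.
    move=> j u v ju uv vj; apply/eqP; rewrite -subr_eq0 -normr_le0.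
    apply/ler_addgt0Pr => e e0; rewrite add0r.
    have [K HK] := kh_L2_inv_lt e0.
    have cv : count_below (v + tau D 0 j) - count_below (u + tau D 0 j)
        - (count_below v - count_below u) @ U -->
        F (v + tau D 0 j) - F (u + tau D 0 j) - (F v - F u).
      by apply: cvgB; apply: cvgB; exact: FU.
    have near_le k : (K <= k)%N -> - e <= (count_below (v + tau D 0 j) k -
        count_below (u + tau D 0 j) k) - (count_below v k - count_below u k) <= e.
      move=> /HK Kk; rewrite -ler_norml; apply: le_trans Kk.
      exact: count_below_exchange.
    rewrite ler_norml; apply/andP; split.
      apply: (cvgr_to_ge cv); apply: nearU; exists K => k /near_le /andP[+ _].
      exact.
    apply: (cvgr_to_le cv); apply: nearU; exists K => k /near_le /andP[_].
    exact.
  apply: (cvgr_to_ge (cvgB (FU (lft D 0 L3)) (FU (lft D 0 L2)))); apply: allU => k /=.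
  suff : 2^-1 <= count_below (lft D 0 L3) k - count_below (lft D 0 L2) k by [].
  rewrite count_below_diff; last by rewrite /= lerDl ltW // kl_gt0.
  rewrite ler_pdivlMr ?h0 //.
  apply: le_trans (second_frequency (piece_pleft D k L2)).
  by rewrite mulrDl lerDl mulr_ge0 // invr_ge0 exprn_ge0.
Qed.

End keane_second_measure.

Section keane_not_uniquely_ergodic.
Context {R : realType} (D : keane R).
Notation T := (ket D).
Notation l := (kl D).

Lemma invariant_distribution (F : R -> R) : {homo F : x y / x <= y} ->
  (forall e : R, 0 < e -> exists2 d, 0 < d & forall x, F (x + d) <= F x + e) ->
  (forall x, x <= 0 -> F x = 0) -> (forall x, 1 <= x -> F x = 1) ->
  (forall j u v, lft D 0 j <= u -> u <= v -> v <= lft D 0 j + l 0 j ->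
    F (v + tau D 0 j) - F (u + tau D 0 j) = F v - F u) ->
  exists2 P : probability (measurableTypeR R) R, invariant_probability T P &
    forall u v, u <= v -> P `[u, v[%classic = (F v - F u)%:E.
Proof.
move=> homo cont F0 F1 ex.
have [P HP] := distribution_measure homo cont F0 F1; exists P => //.
have P1 : P `[0, 1[%classic = 1%E by rewrite HP // (F0 0) // (F1 1) // subr0.
have fP : (P `[0%R, 1%R[%classic < +oo)%E by rewrite P1 ltry.
split=> //; apply: ket_invariant; first exact: fP.
move=> j u v ju uv vj; apply: etrans (HP _ _ _) _; first by rewrite lerD2r.
by rewrite ex //; exact: esym (HP _ _ uv).
Qed.

Lemma ket_not_uniquely_ergodic : ~ uniquely_ergodic T.
Proof.
move=> [mu _ muU].
have [g1 g2 g3 g4] := kl_gt0s D 0; have l1 := kl0 D.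
(* The distribution function of Lebesgue measure on [0, 1), which thus becomes a probability on the
   line by the same construction as the second measure. *)
pose G (x : R) := Num.max 0 (Num.min x 1).
have G0 x : x <= 0 -> G x = 0.
  by move=> x0; apply/max_idPl; rewrite ge_min x0.
have G1 x : 1 <= x -> G x = 1 by move=> x1; rewrite /G (min_idPr x1) (max_idPr ler01).
have Gid x : 0 <= x <= 1 -> G x = x.
  by move=> /andP[x0 x1]; rewrite /G (min_idPl x1) (max_idPr x0).
have GE x : [\/ x <= 0 /\ G x = 0, 0 <= x <= 1 /\ G x = x | 1 <= x /\ G x = 1].
  have [x0|x0] := leP x 0; first by constructor 1; split=> //; exact: G0.
  have [x1|x1] := leP x 1; first by constructor 2; rewrite (ltW x0); split=> //; apply: Gid; rewrite (ltW x0).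
  by constructor 3; split; [exact: ltW|rewrite G1 // ltW].
have Ghomo : {homo G : x y / x <= y}.
  by move=> x y xy; case: (GE x) => -[? ->]; case: (GE y) => -[? ->]; lra.
have Gcont (e : R) : 0 < e -> exists2 d, 0 < d & forall x, G (x + d) <= G x + e.
  move=> e0; exists e => // x.
  by case: (GE x) => -[? ->]; case: (GE (x + e)) => -[? ->]; lra.
have Gex j u v : lft D 0 j <= u -> u <= v -> v <= lft D 0 j + l 0 j ->
    G (v + tau D 0 j) - G (u + tau D 0 j) = G v - G u.
  by move=> ju uv vj; rewrite !Gid; [ring| | | |]; case: j ju vj => /=; lra.
have [P iP PE] := invariant_distribution Ghomo Gcont G0 G1 Gex.
have [F [homo cont F0 F1 [ex FL]]] := second_measure D.
have [P' iP' PE'] := invariant_distribution homo cont F0 F1 ex.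
have L23 : lft D 0 L2 <= lft D 0 L3 by rewrite /= lerDl ltW.
have mI : measurable (`[lft D 0 L2, lft D 0 L3[%classic : set (measurableTypeR R)).
  exact: measurable_itv.
have := muU P iP _ mI; rewrite -(muU P' iP' _ mI) PE // PE' // => -[].
rewrite !Gid /=; [|lra|lra] => E.
rewrite /= in FL.
have : l 0 L2 <= rho D 0 by exact: kl_small.
rewrite /rho expr1 => r0.
have : (kQ D 0)%:R^-1 <= 4^-1 :> R.
  by rewrite lef_pV2 ?posrE ?ltr0n // ?ler_nat ?kQ_ge4 // (leq_trans _ (kQ_ge4 D 0)).
lra.
Qed.

End keane_not_uniquely_ergodic.

(** * Existence of the data *)

Section parameters.

(* Stage k chooses Q_k, q_k, p_k in this order, [p] being p_(k-1). *)
Definition next_Q k (h : letter -> nat) (p : nat) : nat :=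
  (4 + 2 ^ k * cover_size (horizon h k) + p.+1)%N.

Definition next_q k h p : nat := (4 * next_Q k h p ^ k.+1 + horizon h k)%N.

Definition next_p k h p : nat := (2 ^ k.+2 * (h L4 + (next_q k h p).+1 * h L3))%N.

Fixpoint stage k : (letter -> nat) * nat :=
  if k is k'.+1 then
    let: (h, p) := stage k' in
    (fun j => sumn (map h (word (next_p k' h p) (next_q k' h p) j)), next_p k' h p)
  else (fun=> 1%N, 0%N).

Lemma parameters_exist : exists (p q Q : nat -> nat) (h : nat -> letter -> nat),
  [/\ forall j, h 0 j = 1%N,
      forall k j, h k.+1 j = sumn (map (h k) (word (p k) (q k) j)),
      forall k, [/\ (4 <= Q k)%N, (2 ^ k * cover_size (horizon (h k) k) <= Q k)%N &
        (p k < Q k.+1)%N],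
      forall k, (horizon (h k) k <= q k)%N /\ (4 * Q k ^ k.+1 <= q k)%N &
      forall k, (2 ^ k.+2 * (h k L4 + (q k).+1 * h k L3) <= p k * h k L2)%N /\ (0 < p k)%N].
Proof.
pose h k := (stage k).1; pose pl k := (stage k).2.
pose p k := next_p k (h k) (pl k); pose q k := next_q k (h k) (pl k).
pose Q k := next_Q k (h k) (pl k).
have hS k j : h k.+1 j = sumn (map (h k) (word (p k) (q k) j)).
  by rewrite /p /q /h /pl /=; case: (stage k).
have plS k : pl k.+1 = p k by rewrite /p /h /pl /=; case: (stage k).
have h0 k j : (0 < h k j)%N.
  by elim: k j => [//|k IHk] j; rewrite hS; case: j => /=; rewrite addn_gt0 IHk.
exists p, q, Q, h; split=> //.
- move=> k; split.
  + by rewrite /Q /next_Q -!addnA leq_addr.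
  + by rewrite /Q /next_Q addnAC leq_addl.
  + by rewrite {1}/Q /next_Q plS leq_addl.
- by move=> k; split; rewrite /q /next_q ?leq_addl ?leq_addr.
- move=> k; split; first exact: leq_pmulr.
  by rewrite /p /next_p muln_gt0 expn_gt0 addn_gt0 h0.
Qed.

End parameters.

(** * Lengths as limits in nested cones *)

Section lengths.
Context {R : realType} (p q Q : nat -> nat).
Hypothesis Q_ge4 : forall k, (4 <= Q k)%N.
Hypothesis p_lt : forall k, (p k < Q k.+1)%N.
Hypothesis q_ge : forall k, (4 * Q k ^ k.+1 <= q k)%N.
Hypothesis p_gt0 : forall k, (0 < p k)%N.
Implicit Types v : letter -> R.

Let r k : R := (Q k)%:R ^- k.+1.

Let Q0 k : 0 < (Q k)%:R :> R.
Proof. by rewrite ltr0n (leq_trans _ (Q_ge4 k)). Qed.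

Let r0 k : 0 < r k.
Proof. by rewrite invr_gt0 exprn_gt0. Qed.

Definition total v : R := v L1 + v L2 + v L3 + v L4.

(** The homogeneous form of [kl_small]: it is preserved by [refine] and by scaling, and implies the
    absolute bound once [v L3 <= 1]. *)
Definition cone k v : Prop :=
  (forall j, 0 <= v j) /\ forall j, j <> L3 -> v j <= r k * v L3.

(** Each coordinate of the image other than the third is at most [4 * v L3], the worst case being
    the sum in the fourth; in the second, the factor [p k] is absorbed by [Q k.+1]. The third
    coordinate, at least [q k] times [v L3], outweighs this by [q_ge]. *)
Lemma cone_refine k v : cone k.+1 v -> cone k (refine (p k) (q k) v).
Proof.
move=> [v0 vr].
have [v1 v2 v3 v4] := And4 (v0 L1) (v0 L2) (v0 L3) (v0 L4).
split=> [j|j j3].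
  by case: j => /=; rewrite ?addr_ge0 // ?mulr_ge0 // ?addr_ge0.
have rQ : r k.+1 * (p k).+1%:R <= 1.
  rewrite /r mulrC ler_pdivrMr ?exprn_gt0 // mul1r.
  apply: (@le_trans _ _ (Q k.+1)%:R); first by rewrite ler_nat.
  by rewrite exprS ler_peMr ?(ltW (Q0 _)) // exprn_ege1 // ler1n (leq_trans _ (Q_ge4 _)).
have r1 : r k.+1 <= 1.
  by rewrite invf_le1 ?exprn_gt0 // exprn_ege1 // ler1n (leq_trans _ (Q_ge4 _)).
have a1 : v L1 <= v L3 by apply: le_trans (vr L1 _) _; rewrite // ler_piMl.
have a2 : v L2 <= v L3 by apply: le_trans (vr L2 _) _; rewrite // ler_piMl.
have a4 : v L4 <= v L3 by apply: le_trans (vr L4 _) _; rewrite // ler_piMl.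
have b : 4 * v L3 <= r k * refine (p k) (q k) v L3.
  apply: (@le_trans _ _ (r k * ((q k)%:R * v L3))).
    rewrite mulrA ler_wpM2r // /r mulrC ler_pdivlMr ?exprn_gt0 // -natrX -natrM ler_nat.
    exact: q_ge.
  rewrite ler_pM2l // /= lerDr mulr_ge0 // !addr_ge0 //.
apply: le_trans b; case: j j3 => //= _; try lra.
have c1 : (p k)%:R * v L1 <= v L3.
  apply: (@le_trans _ _ ((p k).+1%:R * (r k.+1 * v L3))).
    by apply: ler_pM => //; [rewrite ler_nat|exact: vr].
  by rewrite mulrA (mulrC _ (r _)) ler_piMl.
have c2 : (p k).+1%:R * v L2 <= v L3.
  apply: (@le_trans _ _ ((p k).+1%:R * (r k.+1 * v L3))).
    by rewrite ler_wpM2l //; exact: vr.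
  by rewrite mulrA (mulrC _ (r _)) ler_piMl.
lra.
Qed.

(* Image of the third basis vector by the refinements of levels k, ..., k + i - 1. *)
Fixpoint approx k i : letter -> R :=
  if i is i'.+1 then refine (p k) (q k) (approx k.+1 i')
  else fun j => if j is L3 then 1 else 0.

Lemma approx_cone k i : cone k (approx k i).
Proof.
elim: i k => [|i IHi] k; last exact: cone_refine.
by split=> -[] //= _; rewrite mulr1 ltW.
Qed.

Lemma total_approx k i : total (approx k.+1 i) <= total (approx k i.+1).
Proof.
have [H _] := approx_cone k i.+1.
have E : approx k i.+1 L4 = total (approx k.+1 i) by [].
by rewrite -E [leRHS]/total lerDr; exact: addr_ge0 (addr_ge0 (H _) (H _)) (H _).
Qed.

Lemma total_approx0 k i : total (approx k i) <= total (approx 0 (k + i)).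
Proof.
elim: k i => [//|k IHk] i; apply: le_trans (total_approx k i) _.
by rewrite addSnnS; exact: IHk.
Qed.

Lemma total_approx_ge1 K : 1 <= total (approx 0 K).
Proof.
have := total_approx0 K 0; rewrite addn0; apply: le_trans.
by rewrite /total /= !add0r addr0.
Qed.

Lemma approx_le_total k i j : 0 <= approx k i j <= total (approx k i).
Proof.
have [H _] := approx_cone k i; rewrite H /=.
by have := And4 (H L1) (H L2) (H L3) (H L4); rewrite /total; case: j => -[] *; lra.
Qed.

(* The normalised [approx 0 K] and their descendants converge along an ultrafilter. *)
Lemma lengths_exist : exists l : nat -> letter -> R,
  [/\ forall k j, 0 < l k j,
      forall k i, l k i = refine (p k) (q k) (l k.+1) i,
      l 0 L1 + l 0 L2 + l 0 L3 + l 0 L4 = 1 &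
      forall k j, j <> L3 -> l k j <= (Q k)%:R ^- k.+1].
Proof.
have [U [UP oU Ulim]] := ultrafilter_limits R.
(* All levels share one normalisation, so the recursion is exact as soon as [K > k]. For [K < k] the
   truncated difference leaves the basis vector, still bounded by the total. *)
pose len k j K : R := approx k (K - k) j / total (approx 0 K).
have S0 K : 0 < total (approx 0 K) by rewrite (lt_le_trans _ (total_approx_ge1 K)).
have len01 k j K : 0 <= len k j K <= 1.
  have /andP[a0 a1] := approx_le_total k (K - k) j.
  rewrite /len divr_ge0 ?(ltW (S0 _)) //= ler_pdivrMr // mul1r.
  have [kK|Kk] := leqP k K.
    by apply: le_trans a1 _; have := total_approx0 k (K - k); rewrite subnKC.
  apply: le_trans (total_approx_ge1 K); apply: le_trans a1 _.
  rewrite (_ : K - k = 0)%N; last by apply/eqP; rewrite subn_eq0 ltnW.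
  by rewrite /total /= !add0r addr0.
have /choice[l lU] : forall kj : nat * letter, exists y : R, len kj.1 kj.2 @ U --> y.
  by move=> kj; apply: Ulim => K; exact: len01.
have nearU (P : nat -> Prop) : (exists K, forall k, (K <= k)%N -> P k) -> \forall k \near U, P k.
  by move=> [K HK]; apply: oU; exists K.
have allU (P : nat -> Prop) : (forall k, P k) -> \forall k \near U, P k.
  by move=> HP; apply: nearU; exists 0%N => k _.
have haus := @norm_hausdorff R R.
have l01 k j : 0 <= l (k, j) <= 1.
  apply/andP; split.
    by apply: (cvgr_to_ge (lU (k, j))); apply: allU => K; case/andP: (len01 k j K).
  by apply: (cvgr_to_le (lU (k, j))); apply: allU => K; case/andP: (len01 k j K).
have lcone k j : j <> L3 -> l (k, j) <= r k * l (k, L3).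
  move=> j3; apply: (ler_cvg_to (lU (k, j)) (cvgM (cvg_cst (r k)) (lU (k, L3)))).
  apply: allU => K; rewrite /len /= mulrA ler_wpM2r ?invr_ge0 ?(ltW (S0 _)) //.
  by have [_] := approx_cone k (K - k); apply.
have lS k i : l (k, i) = refine (p k) (q k) (fun j => l (k.+1, j)) i.
  have cvr : (fun K => refine (p k) (q k) (fun j => len k.+1 j K) i) @ U -->
      refine (p k) (q k) (fun j => l (k.+1, j)) i.
    { case: i => /=.
    - by apply: cvgD; [exact: (lU (k.+1, L3))|exact: (lU (k.+1, L4))].
    - apply: cvgD; apply: cvgM; try exact: cvg_cst.
        exact: (lU (k.+1, L1)).
      exact: (lU (k.+1, L2)).
    - apply: cvgD; apply: cvgM; try exact: cvg_cst; last exact: (lU (k.+1, L3)).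
      apply: cvgD; last exact: (lU (k.+1, L4)).
      by apply: cvgD; [exact: (lU (k.+1, L1))|exact: (lU (k.+1, L2))].
    - apply: cvgD; last exact: (lU (k.+1, L4)).
      apply: cvgD; last exact: (lU (k.+1, L3)).
      by apply: cvgD; [exact: (lU (k.+1, L1))|exact: (lU (k.+1, L2))]. }
  apply: (cvg_unique haus (lU (k, i))); apply: cvg_trans cvr; apply: near_eq_cvg.
  apply: nearU; exists k.+1 => K kK /=; rewrite /len.
  have -> : (K - k = (K - k.+1).+1)%N by lia.
  by case: i => /=; ring.
have lt1 : l (0%N, L1) + l (0%N, L2) + l (0%N, L3) + l (0%N, L4) = 1.
  have cvt : (fun K => len 0 L1 K + len 0 L2 K + len 0 L3 K + len 0 L4 K) @ U -->
      l (0%N, L1) + l (0%N, L2) + l (0%N, L3) + l (0%N, L4).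
    apply: cvgD; last exact: (lU (0%N, L4)).
    apply: cvgD; last exact: (lU (0%N, L3)).
    by apply: cvgD; [exact: (lU (0%N, L1))|exact: (lU (0%N, L2))].
  apply: (cvg_unique haus cvt); apply: cvg_near_cst; apply: allU => K.
  rewrite /len subn0 -!mulrDl -[X in X / _]/(total (approx 0 K)).
  by rewrite divff // gt_eqF.
have lk0 k j : 0 <= l (k, j) by case/andP: (l01 k j).
(* Limits give only nonnegativity. By linearity a level with zero total would annihilate the
   previous one, against total 1 at level 0; the cone then gives a positive third length, and
   [refine] makes the other three positive. *)
have lsum k : 0 < l (k, L1) + l (k, L2) + l (k, L3) + l (k, L4).
  elim: k => [|k IHk]; first by rewrite lt1.
  have H := And4 (lk0 k.+1 L1) (lk0 k.+1 L2) (lk0 k.+1 L3) (lk0 k.+1 L4).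
  rewrite lt_neqAle; apply/andP; split; last by case: H; lra.
  apply/eqP => E.
  have [E1 E2 E3 E4] : [/\ l (k.+1, L1) = 0, l (k.+1, L2) = 0, l (k.+1, L3) = 0 & l (k.+1, L4) = 0].
    by case: H => *; split; lra.
  by move: IHk; rewrite !lS /= E1 E2 E3 E4 !(mulr0, addr0) ltxx.
have lt0 k : 0 < l (k, L3).
  rewrite lt_neqAle lk0 andbT eq_sym; apply/eqP => E; have := lsum k.
  have z j : j <> L3 -> l (k, j) = 0.
    by move=> j3; apply/eqP; rewrite eq_le lk0 andbT; have := lcone k j j3; rewrite E mulr0.
  by rewrite E !z // !addr0 ltxx.
have l10 k : 0 < l (k, L1).
  by rewrite lS /=; have := lt0 k.+1; have := lk0 k.+1 L4; lra.
exists (fun k j => l (k, j)); split=> //.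
  move=> k [] //; rewrite lS /= ?lsum // ltr_wpDr ?mulr_ge0 //.
  by rewrite mulr_gt0 // ltr0n.
move=> k j j3; apply: le_trans (lcone k j j3) _.
by rewrite ler_piMr ?(ltW (r0 k)) //; case/andP: (l01 k L3).
Qed.

End lengths.

Lemma keane_exists (R : realType) : inhabited (keane R).
Proof.
have [p [q [Q [h [h0 hS HQ Hq Hp]]]]] := parameters_exist.
have [l [l0 lS l1 lr]] := @lengths_exist R p q Q
  (fun k => let: And3 H _ _ := HQ k in H) (fun k => let: And3 _ _ H := HQ k in H)
  (fun k => (Hq k).2) (fun k => (Hp k).2).
exact: inhabits (Keane h0 hS l0 lS l1 lr (fun k => let: And3 H _ _ := HQ k in H)
  (fun k => let: And3 _ H _ := HQ k in H) (fun k => (Hq k).1) (fun k => (Hp k).1)).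
Qed.

(** * The map as an interval exchange *)

Section keane_iet.
Context {R : realType} (D : keane R).

Definition letter_of (i : 'I_4) : letter := nth L1 [:: L1; L2; L3; L4] i.

(* The images of I_1, ..., I_4 appear in the order I_4, I_2, I_1, I_3. *)
Definition image_rank (i : 'I_4) : 'I_4 := inord (nth 0%N [:: 2; 1; 3; 0]%N i).

Lemma image_rank_inj : injective image_rank.
Proof.
move=> [[|[|[|[|i]]]] Hi] [[|[|[|[|j]]]] Hj] // /(congr1 val) /=; rewrite !inordK // => _;
  exact: val_inj.
Qed.

Lemma ket_is_iet : is_iet (ket D).
Proof.
exists 4, (fun i => kl D 0 (letter_of i)), (perm image_rank_inj).
have sum4 (P : pred 'I_4) (f : 'I_4 -> R) : \sum_(k < 4 | P k) f k =
    (if P ord0 then f ord0 else 0) + (if P (inord 1) then f (inord 1) else 0)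
    + (if P (inord 2) then f (inord 2) else 0) + (if P (inord 3) then f (inord 3) else 0).
  rewrite big_mkcond !big_ord_recl big_ord0 /= addr0 !addrA.
  have E (a b : 'I_4) : val a = val b -> (if P a then f a else 0) = (if P b then f b else 0).
    by move=> /val_inj ->.
  by do ![congr (_ + _)]; apply: E; rewrite /= ?inordK.
have [g1 g2 g3 g4] := kl_gt0s D 0; have l1 := kl0 D.
split.
- by move=> j; exact: kl_gt0.
- by rewrite sum4 /= /letter_of /= !inordK.
- move=> j x; rewrite /iet_interval !sum4 !permE /image_rank /letter_of.
  have rk (i : 'I_4) : (nth 0 [:: 2; 1; 3; 0] i < 4)%N.
    by case: i => [[|[|[|[|i]]]] Hi].
  rewrite !(inordK (rk _)).
  case: j => [[|[|[|[|j]]]] Hj] //=; rewrite !inordK //= inE /= in_itv /= => /andP[x1 x2].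
  1: rewrite (@ket_piece _ D L1).
  3: rewrite (@ket_piece _ D L2).
  5: rewrite (@ket_piece _ D L3).
  7: rewrite (@ket_piece _ D L4).
  all: by rewrite /= ?/piece ?/in_itv_dir /=; first [ring | apply/andP; split; lra].
Qed.

End keane_iet.

Theorem theorem3 (R : realType) :
  exists T : R -> R,
    [/\ is_iet T,
        minimal_map T,
        ~ uniquely_ergodic T,
        ergodic_measure T (@lebesgue_measure R) &
        hausdorff_dim (`[0, 1[ `\` [set x | generic_point T (@lebesgue_measure R) x])
          = 0%E].
Proof.
have [D] := keane_exists R; exists (ket D); split.
- exact: ket_is_iet.
- exact: ket_minimal.
- exact: ket_not_uniquely_ergodic.
- exact: ket_ergodic.
- exact: nongeneric_dim0.
Qed.
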